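(* Let $\mathcal C(D)$, $\mathbb C^{\mathbb N}$ be the represented spaces described in the context. The following three partial (multivalued) functions are pairwise Weihrauch equivalent: (1) closed choice on the naturals $\mathrm{C}_{\mathbb N}$; (2) $\operatorname{Sum}:\subseteq\mathbb C^{\mathbb N}\to\mathcal C(D)$, defined on the sequences $(a_k)_{k\in\mathbb N}$ whose power series has radius of convergence strictly larger than $1$, by $\operatorname{Sum}((a_k)_k)(x)=\sum_{k\in\mathbb N}a_kx^k$; (3) $\operatorname{Adv}_g:\subseteq\mathbb C^{\mathbb N}\rightrightarrows\mathbb N$, defined on the same sequences, with $\operatorname{Adv}_g((a_k)_k)=\{n\in\mathbb N\mid \forall k\in\mathbb N:\ |a_k|\le 2^{-\frac{k}{n+1}}\cdot n\}$.
   Context: A represented space is a set $X$ with a partial surjection $\delta:\subseteq\mathbb{N}^{\mathbb{N}}\to X$ (its names). A realizer of $f:\subseteq\mathbf X\rightrightarrows\mathbf Y$ is a partial $F:\subseteq\mathbb{N}^{\mathbb{N}}\to\mathbb{N}^{\mathbb{N}}$ with $\delta_{\mathbf Y}(F(p))\in f(\delta_{\mathbf X}(p))$ whenever $\delta_{\mathbf X}(p)\in\operatorname{dom} f$. $f\le_W g$ iff there are computable partial $H:\subseteq\mathbb{N}^{\mathbb{N}}\to\mathbb{N}^{\mathbb{N}}$, $K:\subseteq\mathbb{N}^{\mathbb{N}}\times\mathbb{N}^{\mathbb{N}}\to\mathbb{N}^{\mathbb{N}}$ such that for every realizer $G$ of $g$, $p\mapsto K(p,G(H(p)))$ realizes $f$;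 $\equiv_W$ means reducibility in both directions. $\mathbb N$ is represented by $p\mapsto p(0)$. $\mathcal A(\mathbb N)$: subsets $A\subseteq\mathbb N$, where $p$ names $A$ iff $\mathbb N\setminus A=\{p(n)-1\mid p(n)>0\}$; $\mathrm C_{\mathbb N}:\subseteq\mathcal A(\mathbb N)\rightrightarrows\mathbb N$ maps a nonempty $A$ to any of its elements. For a separable metric space $(M,d)$ with fixed dense sequence $(x_n)$, $p$ names $x$ iff $d(x,x_{p(n)})<2^{-n}$ for all $n$; $\mathbb C$ is represented this way with a standard enumeration of the complex rationals, and $\mathcal C(D)$, the continuous functions $D\to\mathbb C$ on the closed unit disk $D\subseteq\mathbb C$, with the supremum metric and a standard enumeration of polynomials with rational coefficients. $\mathbb C^{\mathbb N}$: $p$ names $(x_m)_m$ iff for each $m$, $n\mapsto p(\langle m,n\rangle)$ names $x_m$, where $\langle\cdot,\cdot\rangle$ is a standard computable pairing bijection $\mathbb N^2\to\mathbb N$. *)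

(* Defs.v *)
From Stdlib Require Import Reals Lra Lia List Cantor.
From Stdlib Require Import Classical ClassicalEpsilon.
From Stdlib Require Import FunctionalExtensionality PropExtensionality ProofIrrelevance.
From Coquelicot Require Import Coquelicot.

Local Open Scope R_scope.

Notation cpair m n := (Cantor.to_nat (m%nat, n%nat)).

Definition baire : Type := nat -> nat.

(* Programs for the unary partial recursive functions relative to an oracle;
   several arguments are passed as one number through Cantor pairing. *)
Inductive code : Type :=
| Zero | Succ | Fst | Snd | Oracle
| Pair (a b : code)
| Comp (a b : code)
| Rec (a b : code)
| Mu (a : code).

(* [eval o c x y]: with oracle [o], program [c] halts on input [x] with
   output [y]. *)
Inductive eval (o : baire) : code -> nat -> nat -> Prop :=
| eval_Zero x : eval o Zero x 0
| eval_Succ x : eval o Succ x (S x)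
| eval_Fst x y : eval o Fst (cpair x y) x
| eval_Snd x y : eval o Snd (cpair x y) y
| eval_Oracle x : eval o Oracle x (o x)
| eval_Pair a b x y z :
    eval o a x y -> eval o b x z -> eval o (Pair a b) x (cpair y z)
| eval_Comp a b x y z :
    eval o b x y -> eval o a y z -> eval o (Comp a b) x z
| eval_Rec_0 a b x y :
    eval o a x y -> eval o (Rec a b) (cpair x 0) y
| eval_Rec_S a b x n y z :
    eval o (Rec a b) (cpair x n) y ->
    eval o b (cpair x (cpair n y)) z ->
    eval o (Rec a b) (cpair x (S n)) z
| eval_Mu a x n (h : nat -> nat) :
    (forall m, (m < n)%nat -> eval o a (cpair x m) (S (h m))) ->
    eval o a (cpair x n) 0 ->
    eval o (Mu a) x n.

(* The program may also halt on oracles outside the domain of [F]. *)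
Definition computable (F : baire -> option baire) : Prop :=
  exists c, forall p q, F p = Some q -> forall n, eval p c n (q n).

Definition join (p q : baire) : baire :=
  fun n => if Nat.even n then p (Nat.div2 n) else q (Nat.div2 n).

Definition computable2 (F : baire -> baire -> option baire) : Prop :=
  exists c, forall p q r,
    F p q = Some r -> forall n, eval (join p q) c n (r n).

(* The partial surjection is given by its graph. *)
Record rep_space : Type := RepSpace {
  carrier :> Type;
  names : baire -> carrier -> Prop;
  names_unique : forall p x y, names p x -> names p y -> x = y;
  names_surj : forall x, exists p, names p x
}.
Arguments names {r} p x.

(* The domain is a separate field; [val] is irrelevant outside of it. *)
Record pmfun (X Y : rep_space) : Type := PMFun {
  dom : X -> Prop;
  val : X -> Y -> Prop
}.
Arguments PMFun {X Y} dom val.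
Arguments dom {X Y} f x : rename.
Arguments val {X Y} f x y : rename.

Definition realizes {X Y : rep_space} (F : baire -> option baire)
    (f : pmfun X Y) : Prop :=
  forall p x, names p x -> dom f x ->
    exists q y, F p = Some q /\ names q y /\ val f x y.

Definition opt_bind {A B : Type} (u : option A) (k : A -> option B) : option B :=
  match u with Some a => k a | None => None end.

Definition weihrauch_le {X Y Z W : rep_space}
    (f : pmfun X Y) (g : pmfun Z W) : Prop :=
  exists (H : baire -> option baire) (K : baire -> baire -> option baire),
    computable H /\ computable2 K /\
    forall G : baire -> option baire, realizes G g ->
      realizes (fun p => opt_bind (opt_bind (H p) G) (K p)) f.

Definition weihrauch_equiv {X Y Z W : rep_space}
    (f : pmfun X Y) (g : pmfun Z W) : Prop :=
  weihrauch_le f g /\ weihrauch_le g f.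

Definition nat_space : rep_space.
Proof.
refine (@RepSpace nat (fun p x => p 0%nat = x) _ _).
- congruence.
- intros x; now exists (fun _ => x).
Defined.

Definition closed_nat_names (p : baire) (A : nat -> Prop) : Prop :=
  forall m, ~ A m <-> exists n, (p n > 0)%nat /\ m = (p n - 1)%nat.

Lemma closed_nat_names_unique p A B :
  closed_nat_names p A -> closed_nat_names p B -> A = B.
Proof.
intros HA HB; apply functional_extensionality; intros m.
apply propositional_extensionality.
specialize (HA m); specialize (HB m).
destruct (classic (A m)), (classic (B m)); tauto.
Qed.

Lemma closed_nat_names_surj A : exists p, closed_nat_names p A.
Proof.
exists (fun n => if excluded_middle_informative (A n) then 0%nat else S n).
intros m; split.
- intros H; exists m; destruct (excluded_middle_informative (A m)).
  + tauto.
  + lia.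
- intros [n Hn]; destruct (excluded_middle_informative (A n)).
  + lia.
  + now replace m with n by lia.
Qed.

(* The space A(N) of all subsets of N, given by enumerations of the
   complement. *)
Definition closed_nat_space : rep_space :=
  RepSpace (nat -> Prop) closed_nat_names
    closed_nat_names_unique closed_nat_names_surj.

Definition seq_names {X : rep_space} (p : baire) (x : nat -> X) : Prop :=
  forall m, names (fun n => p (cpair m n)) (x m).

Lemma seq_names_unique {X : rep_space} p (x y : nat -> X) :
  seq_names p x -> seq_names p y -> x = y.
Proof.
intros Hx Hy; apply functional_extensionality; intros m.
exact (names_unique _ _ _ _ (Hx m) (Hy m)).
Qed.

Lemma seq_names_surj {X : rep_space} (x : nat -> X) :
  exists p, seq_names p x.
Proof.
pose (q := fun m =>
  proj1_sig (constructive_indefinite_description _ (names_surj X (x m)))).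
exists (fun k => let (m, n) := Cantor.of_nat k in q m n).
intros m.
replace (fun n => _) with (q m).
- exact (proj2_sig (constructive_indefinite_description _ (names_surj X (x m)))).
- apply functional_extensionality; intros n.
  now rewrite Cantor.cancel_of_to.
Qed.

Definition seq_space (X : rep_space) : rep_space :=
  RepSpace (nat -> X) seq_names seq_names_unique seq_names_surj.

Record sep_metric : Type := SepMetric {
  pt :> Type;
  dist : pt -> pt -> R;
  dist_eq0 : forall x y, dist x y = 0 <-> x = y;
  dist_sym : forall x y, dist x y = dist y x;
  dist_triangle : forall x y z, dist x z <= dist x y + dist y z;
  dense_seq : nat -> pt;
  dense_seqP : forall x eps, 0 < eps -> exists n, dist x (dense_seq n) < eps
}.
Arguments dist {s} x y.
Arguments dense_seq {s} n.

Definition metric_names {M : sep_metric} (p : baire) (x : M) : Prop :=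
  forall n, dist x (dense_seq (p n)) < (/ 2) ^ n.

Lemma pow_half_lt (e : R) : 0 < e -> exists n, (/ 2) ^ n < e.
Proof.
intros He.
destruct (pow_lt_1_zero (/ 2)) with (y := e) as [N HN]; trivial.
- rewrite Rabs_pos_eq; lra.
- exists N; specialize (HN N (le_n N)).
  rewrite Rabs_pos_eq in HN; trivial.
  apply pow_le; lra.
Qed.

Lemma metric_names_unique {M : sep_metric} p (x y : M) :
  metric_names p x -> metric_names p y -> x = y.
Proof.
intros Hx Hy; apply dist_eq0.
assert (H0 : 0 <= dist x y).
{ assert (H := dist_triangle M x y x).
  rewrite (dist_sym M y x), (proj2 (dist_eq0 M x x) eq_refl) in H; lra. }
destruct (Rle_lt_or_eq_dec _ _ H0) as [H | H]; [exfalso | now symmetry].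
destruct (pow_half_lt (dist x y / 2)) as [n Hn]; [lra |].
assert (T := dist_triangle M x (dense_seq (p n)) y).
specialize (Hx n); specialize (Hy n); rewrite dist_sym in Hy; lra.
Qed.

Lemma metric_names_surj {M : sep_metric} (x : M) :
  exists p, metric_names p x.
Proof.
assert (H : forall n, exists k, dist x (dense_seq k) < (/ 2) ^ n).
{ intros n; apply dense_seqP, pow_lt; lra. }
exists (fun n => proj1_sig (constructive_indefinite_description _ (H n))).
intros n.
exact (proj2_sig (constructive_indefinite_description _ (H n))).
Qed.

Definition metric_space (M : sep_metric) : rep_space :=
  RepSpace M metric_names metric_names_unique metric_names_surj.

Definition rat_enum (n : nat) : R :=
  let (m, c) := Cantor.of_nat n in
  let (a, b) := Cantor.of_nat m in
  (INR a - INR b) / INR (S c).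

Definition crat_enum (n : nat) : C :=
  let (a, b) := Cantor.of_nat n in (rat_enum a, rat_enum b).

Lemma rat_enum_dense (x eps : R) :
  0 < eps -> exists n, Rabs (x - rat_enum n) < eps.
Proof.
intros He.
destruct (archimed_cor1 eps He) as [N [HN Npos]].
destruct N as [| c]; [lia |].
assert (Hc : 0 < INR (S c)) by (apply lt_0_INR; lia).
pose (k := (up (x * INR (S c)) - 1)%Z).
exists (cpair (cpair (Z.to_nat k) (Z.to_nat (- k))) c).
unfold rat_enum; rewrite !Cantor.cancel_of_to.
replace (INR (Z.to_nat k) - INR (Z.to_nat (- k))) with (IZR k).
2: { rewrite !INR_IZR_INZ, <- minus_IZR; f_equal; lia. }
destruct (archimed (x * INR (S c))) as [H1 H2].
assert (Hk : IZR k = IZR (up (x * INR (S c))) - 1).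
{ unfold k; now rewrite minus_IZR. }
replace (x - IZR k / INR (S c)) with ((x * INR (S c) - IZR k) * / INR (S c))
  by (field; lra).
rewrite Rabs_mult, (Rabs_pos_eq (/ _)).
2: { apply Rlt_le, Rinv_0_lt_compat, Hc. }
apply Rle_lt_trans with (1 * / INR (S c)); [| lra].
apply Rmult_le_compat_r.
- apply Rlt_le, Rinv_0_lt_compat, Hc.
- rewrite Rabs_pos_eq; lra.
Qed.

Lemma crat_enum_dense (z : C) (eps : R) :
  0 < eps -> exists n, Cmod (z - crat_enum n) < eps.
Proof.
intros He.
destruct (rat_enum_dense (fst z) (eps / 2)) as [a Ha]; [lra |].
destruct (rat_enum_dense (snd z) (eps / 2)) as [b Hb]; [lra |].
exists (cpair a b).
unfold crat_enum; rewrite Cantor.cancel_of_to.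
replace (z - (rat_enum a, rat_enum b))%C
  with (RtoC (fst z - rat_enum a) + Ci * RtoC (snd z - rat_enum b))%C.
2: { destruct z; unfold Cminus, Cplus, Copp, Cmult, Ci, RtoC; simpl.
     f_equal; ring. }
eapply Rle_lt_trans; [apply Cmod_triangle |].
rewrite Cmod_mult, Cmod_Ci, !Cmod_R; lra.
Qed.

Lemma Cdist_eq0 (x y : C) : Cmod (x - y) = 0 <-> x = y.
Proof.
split; intros H.
- apply Ceq_minus, Cmod_eq_0, H.
- apply Ceq_minus in H; rewrite H; apply Cmod_0.
Qed.

Lemma Cdist_sym (x y : C) : Cmod (x - y) = Cmod (y - x).
Proof.
replace (y - x)%C with (- (x - y))%C by ring; now rewrite Cmod_opp.
Qed.

Lemma Cdist_triangle (x y z : C) :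
  Cmod (x - z) <= Cmod (x - y) + Cmod (y - z).
Proof.
replace (x - z)%C with ((x - y) + (y - z))%C by ring; apply Cmod_triangle.
Qed.

Definition C_metric : sep_metric :=
  SepMetric C (fun x y => Cmod (x - y)) Cdist_eq0 Cdist_sym Cdist_triangle
    crat_enum crat_enum_dense.

Definition C_space : rep_space := metric_space C_metric.

Definition disk : Type := {z : C | Cmod z <= 1}.
Definition disk_val (x : disk) : C := proj1_sig x.
Coercion disk_val : disk >-> C.

Record CD : Type := MkCD {
  CD_fun :> disk -> C;
  CD_cont : forall (x : disk) (eps : R), 0 < eps ->
    exists delta, 0 < delta /\
      forall y : disk, Cmod (y - x) < delta ->
        Cmod (CD_fun y - CD_fun x) < eps
}.

Definition sup_dist (f g : CD) : R :=
  real (Lub_Rbar (fun r => exists x : disk, r = Cmod (f x - g x))).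

(* Holomorphic polynomials are not dense in the continuous functions on the
   disk: the polynomials enumerated here have complex rational coefficients and
   are polynomials in [z] and its conjugate, that is, in the two real
   coordinates of [z]. *)
Definition monomial_enum (n : nat) (z : C) : C :=
  let (e, c) := Cantor.of_nat n in
  let (i, j) := Cantor.of_nat e in
  (crat_enum c * (Cpow z i * Cpow (Cconj z) j))%C.

Fixpoint poly_sum (len n : nat) (z : C) : C :=
  match len with
  | O => 0%C
  | S l => let (h, t) := Cantor.of_nat n in
           (monomial_enum h z + poly_sum l t z)%C
  end.

Definition poly_enum (n : nat) (z : C) : C :=
  let (len, m) := Cantor.of_nat n in poly_sum len m z.

Definition lip_bounded (f : C -> C) : Prop :=
  exists L B, 0 <= L /\ 0 <= B /\
    (forall z, Cmod z <= 1 -> Cmod (f z) <= B) /\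
    (forall z w, Cmod z <= 1 -> Cmod w <= 1 ->
       Cmod (f z - f w) <= L * Cmod (z - w)).

Lemma lip_const (c : C) : lip_bounded (fun _ => c).
Proof.
exists 0, (Cmod c); repeat split; try lra.
- apply Cmod_ge_0.
- intros; apply Rle_refl.
- intros; replace (c - c)%C with (RtoC 0) by ring; rewrite Cmod_0; lra.
Qed.

Lemma lip_id : lip_bounded (fun z => z).
Proof. exists 1, 1; repeat split; intros; lra. Qed.

Lemma lip_conj : lip_bounded Cconj.
Proof.
exists 1, 1; repeat split; try lra; intros.
- now rewrite Cmod_conj.
- rewrite <- Cminus_conj, Cmod_conj; lra.
Qed.

Lemma lip_plus f g :
  lip_bounded f -> lip_bounded g -> lip_bounded (fun z => f z + g z)%C.
Proof.
intros (L & B & HL & HB & Hf & Hf') (L' & B' & HL' & HB' & Hg & Hg').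
exists (L + L'), (B + B'); repeat split; try lra.
- intros z Hz; eapply Rle_trans; [apply Cmod_triangle |].
  apply Rplus_le_compat; auto.
- intros z w Hz Hw.
  replace (f z + g z - (f w + g w))%C with ((f z - f w) + (g z - g w))%C by ring.
  eapply Rle_trans; [apply Cmod_triangle |].
  rewrite Rmult_plus_distr_r; apply Rplus_le_compat; auto.
Qed.

Lemma lip_mult f g :
  lip_bounded f -> lip_bounded g -> lip_bounded (fun z => f z * g z)%C.
Proof.
intros (L & B & HL & HB & Hf & Hf') (L' & B' & HL' & HB' & Hg & Hg').
exists (L * B' + B * L'), (B * B'); repeat split; try nra.
- intros z Hz; rewrite Cmod_mult.
  apply Rmult_le_compat; auto using Cmod_ge_0.
- intros z w Hz Hw.
  replace (f z * g z - f w * g w)%C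
    with ((f z - f w) * g z + f w * (g z - g w))%C by ring.
  eapply Rle_trans; [apply Cmod_triangle |]; rewrite !Cmod_mult.
  replace ((L * B' + B * L') * Cmod (z - w))
    with ((L * Cmod (z - w)) * B' + B * (L' * Cmod (z - w))) by ring.
  apply Rplus_le_compat; apply Rmult_le_compat; auto using Cmod_ge_0.
Qed.

Lemma lip_pow f n : lip_bounded f -> lip_bounded (fun z => Cpow (f z) n).
Proof.
intros Hf; induction n as [| n IH].
- exact (lip_const 1).
- exact (lip_mult _ _ Hf IH).
Qed.

Lemma lip_poly_enum n : lip_bounded (poly_enum n).
Proof.
unfold poly_enum; destruct (Cantor.of_nat n) as [len m]; clear n.
revert m; induction len as [| len IH]; intros m; simpl.
- apply lip_const.
- destruct (Cantor.of_nat m) as [h t].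
  apply (lip_plus (monomial_enum h)); [| apply IH].
  unfold monomial_enum; destruct (Cantor.of_nat h) as [e c].
  destruct (Cantor.of_nat e) as [i j].
  apply (lip_mult (fun _ => crat_enum c)); [apply lip_const |].
  apply (lip_mult (fun z => Cpow z i) (fun z => Cpow (Cconj z) j)).
  + apply (lip_pow (fun z => z)), lip_id.
  + apply lip_pow, lip_conj.
Qed.

Lemma poly_enum_cont n (x : disk) (eps : R) : 0 < eps ->
  exists delta, 0 < delta /\ forall y : disk, Cmod (y - x) < delta ->
    Cmod (poly_enum n y - poly_enum n x) < eps.
Proof.
intros He; destruct (lip_poly_enum n) as (L & B & HL & _ & _ & H).
exists (eps / (L + 1)); split.
- apply Rdiv_lt_0_compat; lra.
- intros y Hy.
  eapply Rle_lt_trans; [apply H; [exact (proj2_sig y) | exact (proj2_sig x)] |].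
  assert (H1 : eps / (L + 1) * (L + 1) = eps) by (field; lra).
  assert (H2 := Cmod_ge_0 (y - x)).
  nra.
Qed.

Definition CD_poly (n : nat) : CD :=
  MkCD (fun x => poly_enum n x) (poly_enum_cont n).

Fixpoint cpoly (l : list (nat * nat * C)) (z : C) : C :=
  match l with
  | nil => 0%C
  | (i, j, c) :: l' => (c * (Cpow z i * Cpow (Cconj z) j) + cpoly l' z)%C
  end.

Definition is_cpoly (f : C -> C) : Prop := exists l, forall z, f z = cpoly l z.

Lemma is_cpoly_ext f g :
  (forall z, g z = f z) -> is_cpoly f -> is_cpoly g.
Proof. intros H [l Hl]; exists l; intros z; now rewrite H. Qed.

Lemma is_cpoly_const c : is_cpoly (fun _ => c).
Proof. exists ((0%nat, 0%nat, c) :: nil); intros z; simpl; ring. Qed.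

Lemma is_cpoly_plus f g :
  is_cpoly f -> is_cpoly g -> is_cpoly (fun z => f z + g z)%C.
Proof.
intros [l Hl] [k Hk]; exists (l ++ k)%list; intros z; rewrite Hl, Hk; clear.
induction l as [| [[i j] c] l IH]; simpl; [ring |].
rewrite <- IH; ring.
Qed.

Lemma is_cpoly_scal c f : is_cpoly f -> is_cpoly (fun z => c * f z)%C.
Proof.
intros [l Hl].
exists (map (fun t => (fst (fst t), snd (fst t), (c * snd t)%C)) l).
intros z; rewrite Hl; clear.
induction l as [| [[i j] d] l IH]; simpl; [ring |].
rewrite <- IH; ring.
Qed.

Lemma is_cpoly_mulz f : is_cpoly f -> is_cpoly (fun z => z * f z)%C.
Proof.
intros [l Hl].
exists (map (fun t => (S (fst (fst t)), snd (fst t), snd t)) l).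
intros z; rewrite Hl; clear.
induction l as [| [[i j] d] l IH]; simpl; [ring |].
rewrite <- IH; ring.
Qed.

Lemma is_cpoly_mulzbar f : is_cpoly f -> is_cpoly (fun z => Cconj z * f z)%C.
Proof.
intros [l Hl].
exists (map (fun t => (fst (fst t), S (snd (fst t)), snd t)) l).
intros z; rewrite Hl; clear.
induction l as [| [[i j] d] l IH]; simpl; [ring |].
rewrite <- IH; ring.
Qed.

Lemma is_cpoly_mulre f : is_cpoly f -> is_cpoly (fun z => RtoC (Re z) * f z)%C.
Proof.
intros Hf.
apply is_cpoly_ext with (fun z => / 2 * (z * f z + Cconj z * f z))%C.
- intros z; rewrite re_alt; field.
- apply is_cpoly_scal, is_cpoly_plus;
    [now apply is_cpoly_mulz | now apply is_cpoly_mulzbar].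
Qed.

Lemma is_cpoly_mulim f : is_cpoly f -> is_cpoly (fun z => RtoC (Im z) * f z)%C.
Proof.
intros Hf.
apply is_cpoly_ext
  with (fun z => / (2 * Ci) * (z * f z + (- (1)) * (Cconj z * f z)))%C.
- intros z; rewrite im_alt; field; exact Ci_nz.
- apply is_cpoly_scal, is_cpoly_plus; [now apply is_cpoly_mulz |].
  now apply is_cpoly_scal, is_cpoly_mulzbar.
Qed.

Lemma Cmod_pow_le1 z n : Cmod z <= 1 -> Cmod (Cpow z n) <= 1.
Proof.
intros Hz; rewrite Cmod_pow, <- (pow1 n).
apply pow_incr; split; trivial; apply Cmod_ge_0.
Qed.

Lemma poly_sum_approx l (eps : R) : 0 < eps ->
  exists m, forall z, Cmod z <= 1 ->
    Cmod (cpoly l z - poly_sum (length l) m z) < eps.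
Proof.
revert eps; induction l as [| [[i j] c] l IH]; intros eps He; simpl.
- exists 0%nat; intros z _.
  replace (0 - 0)%C with (RtoC 0) by ring; now rewrite Cmod_0.
- destruct (IH (eps / 2)) as [m Hm]; [lra |].
  destruct (crat_enum_dense c (eps / 2)) as [k Hk]; [lra |].
  exists (cpair (cpair (cpair i j) k) m); intros z Hz.
  rewrite Cantor.cancel_of_to; unfold monomial_enum.
  rewrite !Cantor.cancel_of_to.
  set (P := (Cpow z i * Cpow (Cconj z) j)%C).
  assert (HP : Cmod P <= 1).
  { unfold P; rewrite Cmod_mult, <- (Rmult_1_r 1).
    apply Rmult_le_compat; auto using Cmod_ge_0, Cmod_pow_le1.
    apply Cmod_pow_le1; now rewrite Cmod_conj. }
  replace (c * P + cpoly l z - (crat_enum k * P + poly_sum (length l) m z))%C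
    with ((c - crat_enum k) * P + (cpoly l z - poly_sum (length l) m z))%C
    by ring.
  eapply Rle_lt_trans; [apply Cmod_triangle |].
  specialize (Hm z Hz); rewrite Cmod_mult.
  assert (H1 := Cmod_ge_0 (c - crat_enum k)).
  nra.
Qed.

Lemma cpoly_approx f (eps : R) : is_cpoly f -> 0 < eps ->
  exists n, forall z, Cmod z <= 1 -> Cmod (f z - poly_enum n z) < eps.
Proof.
intros [l Hl] He; destruct (poly_sum_approx l eps He) as [m Hm].
exists (cpair (length l) m); intros z Hz.
unfold poly_enum; rewrite Cantor.cancel_of_to, Hl; auto.
Qed.

(* Expectation of [h] after [m] steps of two independent lazy walks started at
   [(s, t)], with step probabilities [u] and [v]: for [s = t = 0] this is the
   two-dimensional Bernstein operator. *)
Fixpoint walk (u v : R) (m : nat) (h : nat -> nat -> R) (s t : nat) : R :=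
  match m with
  | O => h s t
  | S m' =>
      (1 - u) * (1 - v) * walk u v m' h s t
      + u * (1 - v) * walk u v m' h (S s) t
      + (1 - u) * v * walk u v m' h s (S t)
      + u * v * walk u v m' h (S s) (S t)
  end.

Lemma walk_le u v m h k s t :
  0 <= u <= 1 -> 0 <= v <= 1 ->
  (forall a b, (s <= a <= s + m)%nat -> (t <= b <= t + m)%nat ->
     h a b <= k a b) ->
  walk u v m h s t <= walk u v m k s t.
Proof.
intros Hu Hv; revert s t; induction m as [| m IH]; intros s t H; simpl.
- apply H; lia.
- repeat apply Rplus_le_compat; apply Rmult_le_compat_l;
    try (apply Rmult_le_pos; lra);
    apply IH; intros; apply H; lia.
Qed.

Lemma walk_quad u v m A B c d s t :
  walk u v m
    (fun a b => A + B * ((INR a - c) ^ 2 + (INR b - d) ^ 2)) s t =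
  A + B * ((INR s + INR m * u - c) ^ 2 + INR m * (u * (1 - u))
           + ((INR t + INR m * v - d) ^ 2 + INR m * (v * (1 - v)))).
Proof.
revert s t; induction m as [| m IH]; intros s t.
- simpl; ring.
- cbn [walk]; rewrite !IH, !S_INR; ring.
Qed.

Lemma is_cpoly_walk m h s t :
  is_cpoly (fun z => RtoC (walk ((1 + Re z) / 2) ((1 + Im z) / 2) m h s t)).
Proof.
assert (Hu : forall f, is_cpoly f ->
          is_cpoly (fun z => RtoC ((1 + Re z) / 2) * f z)%C).
{ intros f Hf.
  apply is_cpoly_ext with (fun z => / 2 * (f z + RtoC (Re z) * f z))%C.
  - intros z; rewrite RtoC_div, RtoC_plus by lra; field.
  - apply is_cpoly_scal, is_cpoly_plus; trivial; now apply is_cpoly_mulre. }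
assert (Hv : forall f, is_cpoly f ->
          is_cpoly (fun z => RtoC ((1 + Im z) / 2) * f z)%C).
{ intros f Hf.
  apply is_cpoly_ext with (fun z => / 2 * (f z + RtoC (Im z) * f z))%C.
  - intros z; rewrite RtoC_div, RtoC_plus by lra; field.
  - apply is_cpoly_scal, is_cpoly_plus; trivial; now apply is_cpoly_mulim. }
assert (Hu' : forall f, is_cpoly f ->
          is_cpoly (fun z => RtoC (1 - (1 + Re z) / 2) * f z)%C).
{ intros f Hf.
  apply is_cpoly_ext
    with (fun z => f z + (- (1)) * (RtoC ((1 + Re z) / 2) * f z))%C.
  - intros z; rewrite RtoC_minus; ring.
  - apply is_cpoly_plus; trivial; now apply is_cpoly_scal, Hu. }
assert (Hv' : forall f, is_cpoly f ->
          is_cpoly (fun z => RtoC (1 - (1 + Im z) / 2) * f z)%C).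
{ intros f Hf.
  apply is_cpoly_ext
    with (fun z => f z + (- (1)) * (RtoC ((1 + Im z) / 2) * f z))%C.
  - intros z; rewrite RtoC_minus; ring.
  - apply is_cpoly_plus; trivial; now apply is_cpoly_scal, Hv. }
revert s t; induction m as [| m IH]; intros s t; cbn [walk].
- apply is_cpoly_const.
- set (u := fun z => (1 + Re z) / 2) in *; set (v := fun z => (1 + Im z) / 2) in *.
  apply is_cpoly_ext with (fun z =>
    RtoC (1 - u z) * (RtoC (1 - v z) * RtoC (walk (u z) (v z) m h s t))
    + RtoC (u z) * (RtoC (1 - v z) * RtoC (walk (u z) (v z) m h (S s) t))
    + RtoC (1 - u z) * (RtoC (v z) * RtoC (walk (u z) (v z) m h s (S t)))
    + RtoC (u z) * (RtoC (v z) * RtoC (walk (u z) (v z) m h (S s) (S t))))%C.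
  { intros z; rewrite <- !RtoC_mult, <- !RtoC_plus; f_equal; unfold u, v; ring. }
  repeat apply is_cpoly_plus.
  + apply Hu', Hv', IH.
  + apply Hu, Hv', IH.
  + apply Hu', Hv, IH.
  + apply Hu, Hv, IH.
Qed.

Definition grid (n s : nat) : R := 2 * (INR s / INR n) - 1.

Definition unif_cont_square (g : R -> R -> R) : Prop :=
  forall eps, 0 < eps -> exists delta, 0 < delta /\
    forall x y u v, -1 <= x <= 1 -> -1 <= y <= 1 ->
      -1 <= u <= 1 -> -1 <= v <= 1 ->
      Rabs (u - x) < delta -> Rabs (v - y) < delta ->
      Rabs (g u v - g x y) < eps.

Lemma unif_cont_bound g : unif_cont_square g ->
  exists K, 0 <= K /\
    forall x y u v, -1 <= x <= 1 -> -1 <= y <= 1 ->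
      -1 <= u <= 1 -> -1 <= v <= 1 -> Rabs (g u v - g x y) <= K.
Proof.
intros Hg; destruct (Hg 1 Rlt_0_1) as (d & Hd & H).
destruct (archimed_cor1 (d / 2)) as [N [HN Npos]]; [lra |].
assert (HN0 : 0 < INR N) by (apply lt_0_INR; lia).
exists (INR N); split; [lra |].
intros x y u v Hx Hy Hu Hv.
assert (Hi : 0 < / INR N) by now apply Rinv_0_lt_compat.
pose (P := fun k a b => a + INR k * / INR N * (b - a)).
assert (HP : forall k a b, (k <= N)%nat -> -1 <= a <= 1 -> -1 <= b <= 1 ->
          -1 <= P k a b <= 1).
{ intros k a b Hk Ha Hb; unfold P.
  assert (0 <= INR k * / INR N <= 1).
  { split.
    - apply Rmult_le_pos; [apply pos_INR | lra].
    - rewrite <- (Rinv_r (INR N)) by lra.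
      apply Rmult_le_compat_r; [lra | now apply le_INR]. }
  set (r := INR k * / INR N) in *; split; nra. }
assert (HS : forall k a b, -1 <= a <= 1 -> -1 <= b <= 1 ->
          Rabs (P (S k) a b - P k a b) < d).
{ intros k a b Ha Hb; unfold P; rewrite S_INR.
  replace (_ - _) with (/ INR N * (b - a)) by ring.
  rewrite Rabs_mult, (Rabs_pos_eq (/ INR N)) by lra.
  assert (Rabs (b - a) <= 2) by (apply Rabs_le; lra).
  assert (0 <= Rabs (b - a)) by apply Rabs_pos.
  nra. }
assert (Hind : forall k, (k <= N)%nat ->
          Rabs (g (P k x u) (P k y v) - g x y) <= INR k).
{ induction k as [| k IH]; intros Hk.
  - unfold P; simpl.
    replace (x + 0 * / INR N * (u - x)) with x by ring.
    replace (y + 0 * / INR N * (v - y)) with y by ring.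
    rewrite Rminus_diag, Rabs_R0; lra.
  - rewrite S_INR.
    replace (g (P (S k) x u) (P (S k) y v) - g x y)
      with ((g (P (S k) x u) (P (S k) y v) - g (P k x u) (P k y v))
            + (g (P k x u) (P k y v) - g x y)) by ring.
    eapply Rle_trans; [apply Rabs_triang |].
    assert (IH' := IH ltac:(lia)).
    assert (Rabs (g (P (S k) x u) (P (S k) y v) - g (P k x u) (P k y v)) < 1).
    { apply H; auto; apply HP; auto; lia. }
    lra. }
specialize (Hind N (le_n N)); unfold P in Hind.
replace (x + INR N * / INR N * (u - x)) with u in Hind by (field; lra).
replace (y + INR N * / INR N * (v - y)) with v in Hind by (field; lra).
exact Hind.
Qed.

Lemma bernstein_approx g (eps : R) : unif_cont_square g -> 0 < eps ->
  exists N, forall n, (N <= n)%nat -> forall x y,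
    -1 <= x <= 1 -> -1 <= y <= 1 ->
    Rabs (walk ((1 + x) / 2) ((1 + y) / 2) n
            (fun s t => g (grid n s) (grid n t)) 0 0 - g x y) < eps.
Proof.
intros Hg He.
destruct (unif_cont_bound g Hg) as (K & HK & Kb).
destruct (Hg (eps / 2)) as (d & Hd & Hdel); [lra |].
assert (Hd2 : 0 < d ^ 2) by (apply pow_lt; lra).
assert (He2 : 0 < eps * d ^ 2 / (4 * (K + 1))).
{ apply Rdiv_lt_0_compat; [apply Rmult_lt_0_compat; lra | lra]. }
destruct (archimed_cor1 _ He2) as [N [HN Npos]].
exists N; intros n Hn x y Hx Hy.
assert (HNn : INR N <= INR n) by now apply le_INR.
assert (HN0 : 0 < INR N) by (apply lt_0_INR; lia).
set (u := (1 + x) / 2); set (v := (1 + y) / 2).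
assert (Hu : 0 <= u <= 1) by (unfold u; lra).
assert (Hv : 0 <= v <= 1) by (unfold v; lra).
set (B := 4 * K / (INR n ^ 2 * d ^ 2)).
assert (Hn2 : 0 < INR n ^ 2) by (apply pow_lt; lra).
assert (Hpt : forall a b, (0 <= a <= 0 + n)%nat -> (0 <= b <= 0 + n)%nat ->
   Rabs (g (grid n a) (grid n b) - g x y) <=
   eps / 2 + B * ((INR a - INR n * u) ^ 2 + (INR b - INR n * v) ^ 2)).
{ intros a b Ha Hb.
  assert (Hgr : forall k, (0 <= k <= 0 + n)%nat -> -1 <= grid n k <= 1).
  { intros k Hk; unfold grid.
    assert (0 <= INR k / INR n <= 1); [| lra].
    split.
    - apply Rdiv_le_0_compat; [apply pos_INR | lra].
    - apply Rle_div_l; [lra | rewrite Rmult_1_l; apply le_INR; lia]. }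
  assert (Hxa : INR a - INR n * u = INR n * (grid n a - x) / 2).
  { unfold grid, u; field; lra. }
  assert (Hyb : INR b - INR n * v = INR n * (grid n b - y) / 2).
  { unfold grid, v; field; lra. }
  rewrite Hxa, Hyb.
  replace (B * _) with
    (K * (((grid n a - x) ^ 2 + (grid n b - y) ^ 2) / d ^ 2)).
  2: { unfold B; field; split; lra. }
  set (p := grid n a) in *; set (q := grid n b) in *.
  assert (Hsq : 0 <= ((p - x) ^ 2 + (q - y) ^ 2) / d ^ 2).
  { apply Rdiv_le_0_compat; trivial.
    apply Rplus_le_le_0_compat; apply pow2_ge_0. }
  destruct (Rlt_dec (Rabs (p - x)) d) as [H1 | H1];
  [destruct (Rlt_dec (Rabs (q - y)) d) as [H2 | H2] |].
  - assert (Rabs (g p q - g x y) < eps / 2)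
      by (apply Hdel; trivial; apply Hgr; trivial).
    nra.
  - assert (Rabs (g p q - g x y) <= K)
      by (apply Kb; trivial; apply Hgr; trivial).
    assert (1 <= ((p - x) ^ 2 + (q - y) ^ 2) / d ^ 2); [| nra].
    apply Rle_div_r; trivial.
    rewrite <- (pow2_abs (q - y)).
    assert (0 <= (p - x) ^ 2) by apply pow2_ge_0.
    assert (d ^ 2 <= Rabs (q - y) ^ 2) by (apply pow_incr; lra).
    lra.
  - assert (Rabs (g p q - g x y) <= K)
      by (apply Kb; trivial; apply Hgr; trivial).
    assert (1 <= ((p - x) ^ 2 + (q - y) ^ 2) / d ^ 2); [| nra].
    apply Rle_div_r; trivial.
    rewrite <- (pow2_abs (p - x)).
    assert (0 <= (q - y) ^ 2) by apply pow2_ge_0.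
    assert (d ^ 2 <= Rabs (p - x) ^ 2) by (apply pow_incr; lra).
    lra. }
assert (Hup : walk u v n (fun s t => g (grid n s) (grid n t)) 0 0 <=
   walk u v n (fun a b => (g x y + eps / 2)
     + B * ((INR a - INR n * u) ^ 2 + (INR b - INR n * v) ^ 2)) 0 0).
{ apply walk_le; trivial; intros a b Ha Hb.
  assert (H := Hpt a b Ha Hb); apply Rabs_le_between in H; lra. }
assert (Hlo : walk u v n (fun a b => (g x y - eps / 2)
     + (- B) * ((INR a - INR n * u) ^ 2 + (INR b - INR n * v) ^ 2)) 0 0 <=
   walk u v n (fun s t => g (grid n s) (grid n t)) 0 0).
{ apply walk_le; trivial; intros a b Ha Hb.
  assert (H := Hpt a b Ha Hb); apply Rabs_le_between in H; lra. }
rewrite walk_quad in Hup, Hlo.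
change (INR 0) with 0 in Hup, Hlo.
set (V := (0 + INR n * u - INR n * u) ^ 2 + INR n * (u * (1 - u)) +
          ((0 + INR n * v - INR n * v) ^ 2 + INR n * (v * (1 - v)))) in *.
assert (HV : V <= INR n / 2).
{ unfold V.
  replace ((0 + INR n * u - INR n * u) ^ 2) with 0 by ring.
  replace ((0 + INR n * v - INR n * v) ^ 2) with 0 by ring.
  assert (u * (1 - u) <= / 4) by (assert (0 <= (u - / 2) ^ 2) by apply pow2_ge_0; nra).
  assert (v * (1 - v) <= / 4) by (assert (0 <= (v - / 2) ^ 2) by apply pow2_ge_0; nra).
  nra. }
assert (HB0 : 0 <= B).
{ unfold B; apply Rdiv_le_0_compat; [lra | apply Rmult_lt_0_compat; lra]. }
assert (HBV : B * V < eps / 2).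
{ apply Rle_lt_trans with (B * (INR n / 2)).
  { apply Rmult_le_compat_l; trivial. }
  replace (B * (INR n / 2)) with (2 * K / d ^ 2 * / INR n).
  2: { unfold B; field; split; lra. }
  assert (Hin : / INR n <= / INR N) by (apply Rinv_le_contravar; lra).
  assert (HKd : 0 <= 2 * K / d ^ 2) by (apply Rdiv_le_0_compat; lra).
  apply Rle_lt_trans with (2 * K / d ^ 2 * (eps * d ^ 2 / (4 * (K + 1)))).
  { apply Rmult_le_compat_l; lra. }
  replace (2 * K / d ^ 2 * (eps * d ^ 2 / (4 * (K + 1))))
    with (eps / 2 * (K / (K + 1))) by (field; split; lra).
  assert (K / (K + 1) < 1) by (apply Rlt_div_l; lra).
  nra. }
apply Rabs_def1; lra.
Qed.

Definition retract (z : C) : C := (z / RtoC (Rmax 1 (Cmod z)))%C.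

Lemma retract_disk z : Cmod (retract z) <= 1.
Proof.
unfold retract; assert (H := Rmax_l 1 (Cmod z)).
rewrite Cmod_div by (intros E; apply RtoC_inj in E; lra).
rewrite Cmod_R, Rabs_pos_eq by lra.
apply Rle_div_l; [lra |].
rewrite Rmult_1_l; apply Rmax_r.
Qed.

Lemma retract_id z : Cmod z <= 1 -> retract z = z.
Proof. intros H; unfold retract; rewrite Rmax_left by exact H; field. Qed.

Lemma retract_lip z w : Cmod (retract z - retract w) <= 2 * Cmod (z - w).
Proof.
assert (HM := Rmax_l 1 (Cmod z)); assert (HN := Rmax_l 1 (Cmod w)).
unfold retract; set (M := Rmax 1 (Cmod z)) in *; set (N := Rmax 1 (Cmod w)) in *.
assert (HM0 : RtoC M <> 0%C) by (intros E; apply RtoC_inj in E; lra).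
assert (HN0 : RtoC N <> 0%C) by (intros E; apply RtoC_inj in E; lra).
replace (z / RtoC M - w / RtoC N)%C
  with ((z - w) / RtoC M + (w / RtoC N) * (RtoC (N - M) / RtoC M))%C.
2: { rewrite RtoC_minus; field; now split. }
eapply Rle_trans; [apply Cmod_triangle |].
rewrite Cmod_mult, !(Cmod_div _ (RtoC M)), !Cmod_R, (Rabs_pos_eq M)
  by (trivial; lra).
assert (HwN : Cmod (w / RtoC N) <= 1) by apply (retract_disk w).
assert (HNM : Rabs (N - M) <= Cmod (z - w)).
{ assert (H1 := Cmod_triangle (z - w) w).
  replace (z - w + w)%C with z in H1 by ring.
  assert (H2 := Cmod_triangle (w - z) z).
  replace (w - z + z)%C with w in H2 by ring.
  rewrite Cdist_sym in H2.
  apply Rabs_le; unfold M, N, Rmax.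
  destruct (Rle_dec 1 (Cmod w)), (Rle_dec 1 (Cmod z)); lra. }
assert (Hdiv : forall r, 0 <= r -> 0 <= r / M <= r).
{ intros r Hr; split.
  - apply Rdiv_le_0_compat; lra.
  - apply Rle_div_l; [lra | nra]. }
assert (H1 := Hdiv _ (Cmod_ge_0 (z - w))).
assert (H2 := Hdiv _ (Rabs_pos (N - M))).
assert (H3 := Cmod_ge_0 (w / RtoC N)).
nra.
Qed.

Definition CD_ext (f : CD) (x y : R) : C :=
  f (exist _ (retract (x, y)) (retract_disk (x, y))).

Lemma CD_ext_cont (f : CD) x y (eps : R) : 0 < eps ->
  exists delta, 0 < delta /\ forall u v,
    Rabs (u - x) < delta -> Rabs (v - y) < delta ->
    Cmod (CD_ext f u v - CD_ext f x y) < eps.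
Proof.
intros He.
destruct (CD_cont f (exist _ (retract (x, y)) (retract_disk (x, y))) eps He)
  as (d & Hd & H).
exists (d / 4); split; [lra |].
intros u v Hu Hv; apply H; simpl.
eapply Rle_lt_trans; [apply retract_lip |].
replace ((u, v) - (x, y))%C with (RtoC (u - x) + Ci * RtoC (v - y))%C.
2: { unfold Cminus, Cplus, Copp, Cmult, Ci, RtoC; simpl; f_equal; ring. }
assert (T := Cmod_triangle (RtoC (u - x)) (Ci * RtoC (v - y))).
rewrite Cmod_mult, Cmod_Ci, !Cmod_R in T; lra.
Qed.

Lemma im_le_Cmod (c : C) : Rabs (Im c) <= Cmod c.
Proof. eapply Rle_trans; [apply Rmax_r | apply Rmax_Cmod]. Qed.

Lemma CD_ext_unif (f : CD) :
  unif_cont_square (fun x y => Re (CD_ext f x y)) /\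
  unif_cont_square (fun x y => Im (CD_ext f x y)).
Proof.
assert (Hgen : forall g : R -> R -> R,
   (forall x y u v, Rabs (g u v - g x y) <= Cmod (CD_ext f u v - CD_ext f x y)) ->
   unif_cont_square g).
{ intros g Hg eps He.
  destruct (uniform_continuity_2d g (-1) 1 (-1) 1) with (eps := mkposreal eps He)
    as [d Hd].
  - intros x y _ _ [e He'].
    destruct (CD_ext_cont f x y e He') as (d & Hd & H).
    exists (mkposreal d Hd); intros u v Hu Hv; simpl in *.
    eapply Rle_lt_trans; [apply Hg | now apply H].
  - exists d; split; [apply cond_pos |].
    intros x y u v Hx Hy Hu Hv H1 H2; now apply Hd. }
split; apply Hgen; intros x y u v.
- exact (re_le_Cmod (CD_ext f u v - CD_ext f x y)).
- exact (im_le_Cmod (CD_ext f u v - CD_ext f x y)).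
Qed.

Lemma CD_approx (f : CD) (eps : R) : 0 < eps ->
  exists n, forall x : disk, Cmod (f x - poly_enum n x) < eps.
Proof.
intros He; destruct (CD_ext_unif f) as [Hre Him].
destruct (bernstein_approx _ (eps / 3) Hre) as [N1 H1]; [lra |].
destruct (bernstein_approx _ (eps / 3) Him) as [N2 H2]; [lra |].
set (N := Nat.max N1 N2).
specialize (H1 N ltac:(lia)); specialize (H2 N ltac:(lia)).
set (h1 := fun s t => Re (CD_ext f (grid N s) (grid N t))) in H1.
set (h2 := fun s t => Im (CD_ext f (grid N s) (grid N t))) in H2.
pose (P := fun z => (RtoC (walk ((1 + Re z) / 2) ((1 + Im z) / 2) N h1 0 0)
        + Ci * RtoC (walk ((1 + Re z) / 2) ((1 + Im z) / 2) N h2 0 0))%C).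
assert (HP : is_cpoly P).
{ apply is_cpoly_plus; [| apply is_cpoly_scal]; apply is_cpoly_walk. }
destruct (cpoly_approx P (eps / 3) HP) as [n Hn]; [lra |].
exists n; intros x.
assert (Hx := proj2_sig x : Cmod x <= 1).
assert (Hxr : -1 <= Re x <= 1).
{ apply Rabs_le_between; eapply Rle_trans; [apply re_le_Cmod | exact Hx]. }
assert (Hxi : -1 <= Im x <= 1).
{ apply Rabs_le_between; eapply Rle_trans; [apply im_le_Cmod | exact Hx]. }
assert (Hfx : CD_ext f (Re x) (Im x) = f x).
{ unfold CD_ext; f_equal.
  destruct x as [[a b] Hz]; simpl.
  assert (E := retract_id (a, b) Hz).
  generalize (retract_disk (a, b)); rewrite E; intros Hz'.
  f_equal; apply proof_irrelevance. }
specialize (H1 _ _ Hxr Hxi); specialize (H2 _ _ Hxr Hxi).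
rewrite Hfx in H1, H2.
eapply Rle_lt_trans; [apply (Cdist_triangle _ (P x)) |].
specialize (Hn x Hx).
assert (Cmod (f x - P x) < eps / 3 + eps / 3); [| lra].
rewrite Cdist_sym.
replace (P x - f x)%C with
  (RtoC (walk ((1 + Re x) / 2) ((1 + Im x) / 2) N h1 0 0 - Re (f x))
   + Ci * RtoC (walk ((1 + Re x) / 2) ((1 + Im x) / 2) N h2 0 0 - Im (f x)))%C.
2: { unfold P; rewrite !RtoC_minus; destruct (f x) as [a b].
     unfold Cminus, Cplus, Copp, Cmult, Ci, RtoC; simpl; f_equal; ring. }
eapply Rle_lt_trans; [apply Cmod_triangle |].
rewrite Cmod_mult, Cmod_Ci, !Cmod_R; lra.
Qed.

Lemma disk0P : Cmod 0 <= 1.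
Proof. rewrite Cmod_0; lra. Qed.

Definition disk0 : disk := exist _ (RtoC 0) disk0P.

Lemma CD_bounded (f : CD) : exists B, forall x, Cmod (f x) <= B.
Proof.
destruct (CD_approx f 1 Rlt_0_1) as [n Hn].
destruct (lip_poly_enum n) as (L & B & _ & _ & H & _).
exists (1 + B); intros x.
replace (f x) with ((f x - poly_enum n x) + poly_enum n x)%C by ring.
eapply Rle_trans; [apply Cmod_triangle |].
specialize (Hn x); specialize (H x (proj2_sig x)); lra.
Qed.

Lemma sup_dist_spec (f g : CD) :
  (forall x, Cmod (f x - g x) <= sup_dist f g) /\
  (forall B, (forall x, Cmod (f x - g x) <= B) -> sup_dist f g <= B).
Proof.
unfold sup_dist; set (E := fun r => exists x : disk, r = Cmod (f x - g x)).
destruct (Lub_Rbar_correct E) as [Hub Hlub].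
assert (Hbd : exists B, forall x, Cmod (f x - g x) <= B).
{ destruct (CD_bounded f) as [B HB], (CD_bounded g) as [B' HB'].
  exists (B + B'); intros x; unfold Cminus.
  eapply Rle_trans; [apply Cmod_triangle |]; rewrite Cmod_opp.
  specialize (HB x); specialize (HB' x); lra. }
assert (Hb : forall B, (forall x, Cmod (f x - g x) <= B) ->
          Rbar_le (Lub_Rbar E) B).
{ intros B HB; apply Hlub; intros r [x ->]; apply HB. }
destruct Hbd as [B0 HB0].
assert (Hb0 := Hb B0 HB0).
assert (H0 := Hub _ (ex_intro _ disk0 eq_refl)).
destruct (Lub_Rbar E) as [l | |]; simpl in *; try contradiction.
split.
- intros x; exact (Hub _ (ex_intro _ x eq_refl)).
- exact Hb.
Qed.

Lemma sup_dist_eq0 f g : sup_dist f g = 0 <-> f = g.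
Proof.
destruct (sup_dist_spec f g) as [Hub Hlub]; split.
- intros H.
  assert (E : CD_fun f = CD_fun g).
  { apply functional_extensionality; intros x; apply Cdist_eq0.
    specialize (Hub x); assert (H1 := Cmod_ge_0 (f x - g x)); lra. }
  destruct f as [f Hf], g as [g Hg]; simpl in E; subst g.
  f_equal; apply proof_irrelevance.
- intros ->; apply Rle_antisym.
  + apply Hlub; intros x; apply Req_le; now apply Cdist_eq0.
  + eapply Rle_trans; [| apply (Hub disk0)]; apply Cmod_ge_0.
Qed.

Lemma sup_dist_sym f g : sup_dist f g = sup_dist g f.
Proof.
destruct (sup_dist_spec f g) as [H1 H2], (sup_dist_spec g f) as [H3 H4].
apply Rle_antisym; [apply H2 | apply H4]; intros x; rewrite Cdist_sym; auto.
Qed.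

Lemma sup_dist_triangle f g h : sup_dist f h <= sup_dist f g + sup_dist g h.
Proof.
apply sup_dist_spec; intros x.
eapply Rle_trans; [apply (Cdist_triangle _ (g x)) |].
apply Rplus_le_compat; apply sup_dist_spec.
Qed.

Lemma CD_poly_dense f (eps : R) :
  0 < eps -> exists n, sup_dist f (CD_poly n) < eps.
Proof.
intros He; destruct (CD_approx f (eps / 2)) as [n Hn]; [lra |].
exists n; apply Rle_lt_trans with (eps / 2); [| lra].
apply sup_dist_spec; intros x; now apply Rlt_le, Hn.
Qed.

Definition CD_metric : sep_metric :=
  SepMetric CD sup_dist sup_dist_eq0 sup_dist_sym sup_dist_triangle
    CD_poly CD_poly_dense.

Definition CD_space : rep_space := metric_space CD_metric.

Definition closed_choice_nat : pmfun closed_nat_space nat_space :=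
  @PMFun closed_nat_space nat_space
    (fun A : nat -> Prop => exists n, A n)
    (fun (A : nat -> Prop) (n : nat) => A n).

Definition conv_radius (a : nat -> C) : Rbar :=
  Lub_Rbar (fun r => exists z : C,
    r = Cmod z /\ @ex_pseries C_AbsRing C_NormedModule a z).

Definition large_radius (a : nat -> C) : Prop := Rbar_lt 1 (conv_radius a).

Definition power_sum : pmfun (seq_space C_space) CD_space :=
  @PMFun (seq_space C_space) CD_space large_radius
    (fun (a : nat -> C) (f : CD) =>
       forall x : disk, @is_pseries C_AbsRing C_NormedModule a (x : C) (f x)).

Definition adv_geometric : pmfun (seq_space C_space) nat_space :=
  @PMFun (seq_space C_space) nat_space large_radius
    (fun (a : nat -> C) (n : nat) =>
       forall k : nat,
         Cmod (a k) <= Rpower 2 (- (INR k / INR (n + 1))) * INR n).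

(* Main.v *)
(** The three problems are reduced to each other in a cycle.
    Given an enumeration of the complement of a nonempty [A], let [g s] be a
    guess at an element of [A] that increases by one at stage [s] whenever it is
    seen to lie outside [A]. The increments [a_s] of [g] are finitely often
    nonzero and their power series has at [1] the value [lim g], an element of
    [A], which is a natural number and so can be read off an approximation.
    If [|a_k| <= n 2^(-k/(n+1))] then the tail of the power series on the disk
    has an explicit bound, because [1 - 2^(-1/(n+1)) >= 1/(2(n+1))]; so
    polynomials with rational approximations of the [a_k] as coefficients
    converge to the sum at a computable rate.
    Finally, that the rational approximations [q_k] of [a_k] up to [2^-k] satisfy
    [|q_k| <= n 2^-(k div (n+1))] in each coordinate is a co-enumerable property
    of [n] which holds for some [n], and it makes [4 n + 2] a correct advice. *)

From Stdlib Require Import Reals Lra Lia Cantor.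
From Stdlib Require Import ClassicalEpsilon FunctionalExtensionality.
From Coquelicot Require Import Coquelicot.
Require Import Defs.

Local Open Scope nat_scope.

Notation lproj n := (fst (Cantor.of_nat n)).
Notation rproj n := (snd (Cantor.of_nat n)).

(** * Total computable functionals *)

(** One program serves all oracles. The maps of the three basic reductions are total, so closure
    properties are developed for total functionals only. *)
Definition total_computable (f : baire -> nat -> nat) : Prop :=
  exists c, forall o x, eval o c x (f o x).

Lemma tc_ext f g :
  (forall o x, f o x = g o x) -> total_computable f -> total_computable g.
Proof. intros H [c Hc]; exists c; intros o x; rewrite <- H; apply Hc. Qed.

Lemma eval_left o x : eval o Fst x (lproj x).
Proof.
rewrite <- (Cantor.cancel_to_of x) at 1; destruct (Cantor.of_nat x) as [a b].
apply eval_Fst.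
Qed.

Lemma eval_right o x : eval o Snd x (rproj x).
Proof.
rewrite <- (Cantor.cancel_to_of x) at 1; destruct (Cantor.of_nat x) as [a b].
apply eval_Snd.
Qed.

(** The language has no identity program; re-pairing both projections gives one because Cantor
    pairing is onto. *)
Lemma eval_id o x : eval o (Pair Fst Snd) x x.
Proof.
assert (H := eval_Pair o _ _ _ _ _ (eval_left o x) (eval_right o x)).
now rewrite <- surjective_pairing, Cantor.cancel_to_of in H.
Qed.

Lemma tc_comp f g : total_computable f -> total_computable g ->
  total_computable (fun o x => f o (g o x)).
Proof.
intros [c Hc] [d Hd]; exists (Comp c d); intros o x.
eapply eval_Comp; eauto.
Qed.

Lemma tc_id : total_computable (fun _ x => x).
Proof. exists (Pair Fst Snd); intros; apply eval_id. Qed.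

Lemma tc_left f :
  total_computable f -> total_computable (fun o x => lproj (f o x)).
Proof. apply (tc_comp (fun _ x => lproj x)); exists Fst; intros; apply eval_left. Qed.

Lemma tc_right f :
  total_computable f -> total_computable (fun o x => rproj (f o x)).
Proof. apply (tc_comp (fun _ x => rproj x)); exists Snd; intros; apply eval_right. Qed.

Lemma tc_succ f :
  total_computable f -> total_computable (fun o x => S (f o x)).
Proof. apply (tc_comp (fun _ x => S x)); exists Succ; intros; apply eval_Succ. Qed.

Lemma tc_oracle f :
  total_computable f -> total_computable (fun o x => o (f o x)).
Proof. apply (tc_comp (fun o x => o x)); exists Oracle; intros; apply eval_Oracle. Qed.

Lemma tc_const n : total_computable (fun _ _ => n).
Proof.
induction n as [| n IH].
- exists Zero; intros; apply eval_Zero.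
- now apply tc_succ.
Qed.

Lemma tc_pair f g : total_computable f -> total_computable g ->
  total_computable (fun o x => cpair (f o x) (g o x)).
Proof.
intros [c Hc] [d Hd]; exists (Pair c d); intros o x; now apply eval_Pair.
Qed.

(** [Rec] hands its step a single number coding the input, the counter and the previous value; hence
    the shape of the third hypothesis. *)
Lemma tc_rec (b k : baire -> nat -> nat) (s : baire -> nat -> nat -> nat -> nat) :
  total_computable b -> total_computable k ->
  total_computable (fun o v => s o (lproj v) (lproj (rproj v)) (rproj (rproj v))) ->
  total_computable (fun o x => nat_rect (fun _ => nat) (b o x) (s o x) (k o x)).
Proof.
intros [c Hc] [d Hd] [e He].
exists (Comp (Rec c e) (Pair (Pair Fst Snd) d)); intros o x.
eapply eval_Comp; [apply eval_Pair; [apply eval_id | apply Hd] |].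
induction (k o x) as [| n IH]; simpl.
- apply eval_Rec_0, Hc.
- eapply eval_Rec_S; [exact IH |].
  specialize (He o (cpair x (cpair n
    (nat_rect (fun _ => nat) (b o x) (s o x) n)))).
  rewrite !Cantor.cancel_of_to in He; cbn [fst snd] in He.
  rewrite Cantor.cancel_of_to in He; exact He.
Qed.

Lemma tc_mu (t : baire -> nat -> nat -> nat) (m : baire -> nat -> nat) :
  total_computable (fun o v => t o (lproj v) (rproj v)) ->
  (forall o x, t o x (m o x) = 0) ->
  (forall o x n, n < m o x -> 0 < t o x n) ->
  total_computable m.
Proof.
intros [c Hc] H0 Hpos; exists (Mu c); intros o x.
assert (H : forall n, eval o c (cpair x n) (t o x n)).
{ intros n; specialize (Hc o (cpair x n)).
  now rewrite Cantor.cancel_of_to in Hc. }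
apply eval_Mu with (h := fun n => pred (t o x n)).
- intros n Hn; specialize (H n); specialize (Hpos o x n Hn).
  now rewrite Nat.succ_pred by lia.
- rewrite <- (H0 o x); apply H.
Qed.

Lemma tc_case b f g :
  total_computable b -> total_computable f -> total_computable g ->
  total_computable (fun o x => match b o x with 0 => f o x | S _ => g o x end).
Proof.
intros Hb Hf Hg.
apply tc_ext with
  (fun o x => nat_rect (fun _ => nat) (f o x) (fun _ _ => g o x) (b o x)).
- intros o x; now destruct (b o x).
- apply tc_rec; trivial.
  apply (tc_comp g); trivial; apply tc_left, tc_id.
Qed.

Lemma tc_pred f :
  total_computable f -> total_computable (fun o x => pred (f o x)).
Proof.
intros Hf.
apply tc_ext with (fun o x => nat_rect (fun _ => nat) 0 (fun n _ => n) (f o x)).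
- intros o x; now destruct (f o x).
- apply tc_rec; trivial; [apply tc_const |].
  apply tc_left, tc_right, tc_id.
Qed.

Lemma tc_add f g : total_computable f -> total_computable g ->
  total_computable (fun o x => f o x + g o x).
Proof.
intros Hf Hg.
apply tc_ext with
  (fun o x => nat_rect (fun _ => nat) (f o x) (fun _ y => S y) (g o x)).
- intros o x; induction (g o x); simpl; lia.
- apply tc_rec; trivial.
  apply tc_succ, tc_right, tc_right, tc_id.
Qed.

Lemma tc_mul f g : total_computable f -> total_computable g ->
  total_computable (fun o x => f o x * g o x).
Proof.
intros Hf Hg.
apply tc_ext with
  (fun o x => nat_rect (fun _ => nat) 0 (fun _ y => f o x + y) (g o x)).
- intros o x; induction (g o x); simpl; lia.
- apply tc_rec; trivial; [apply tc_const |].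
  apply tc_add; [| apply tc_right, tc_right, tc_id].
  apply (tc_comp f); trivial; apply tc_left, tc_id.
Qed.

Lemma tc_sub f g : total_computable f -> total_computable g ->
  total_computable (fun o x => f o x - g o x).
Proof.
intros Hf Hg.
apply tc_ext with
  (fun o x => nat_rect (fun _ => nat) (f o x) (fun _ y => pred y) (g o x)).
- intros o x; induction (g o x); simpl; lia.
- apply tc_rec; trivial.
  apply tc_pred, tc_right, tc_right, tc_id.
Qed.

Lemma tc_pow2 f :
  total_computable f -> total_computable (fun o x => 2 ^ f o x).
Proof.
intros Hf.
apply tc_ext with (fun o x => nat_rect (fun _ => nat) 1 (fun _ y => y + y) (f o x)).
- intros o x; induction (f o x); simpl; lia.
- apply tc_rec; trivial; [apply tc_const |].
  apply tc_add; apply tc_right, tc_right, tc_id.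
Qed.

Ltac tc :=
  repeat first
    [ assumption | apply tc_const | apply tc_id | apply tc_left | apply tc_right
    | apply tc_oracle | apply tc_pair | apply tc_succ | apply tc_add
    | apply tc_mul | apply tc_sub | apply tc_pow2 | apply tc_case ].

(** * Parity, halving and division *)

Definition parity (n : nat) : nat := if Nat.even n then 0 else 1.

Lemma parity_S n : parity (S n) = 1 - parity n.
Proof.
unfold parity; rewrite Nat.even_succ, <- Nat.negb_even.
now destruct (Nat.even n).
Qed.

Lemma div2_S n : Nat.div2 (S n) = Nat.div2 n + parity n.
Proof.
assert (H1 := Nat.div2_odd n); assert (H2 := Nat.div2_odd (S n)).
unfold parity; rewrite Nat.odd_succ in H2; rewrite <- Nat.negb_even in H1.
destruct (Nat.even n); simpl Nat.b2n in *; lia.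
Qed.

Lemma tc_parity f :
  total_computable f -> total_computable (fun o x => parity (f o x)).
Proof.
intros Hf.
apply tc_ext with (fun o x => nat_rect (fun _ => nat) 0 (fun _ y => 1 - y) (f o x)).
- intros o x; induction (f o x) as [| n IH]; trivial.
  now rewrite parity_S, <- IH.
- apply tc_rec; tc.
Qed.

Lemma tc_div2 f :
  total_computable f -> total_computable (fun o x => Nat.div2 (f o x)).
Proof.
intros Hf.
apply tc_ext with
  (fun o x => nat_rect (fun _ => nat) 0 (fun n y => y + parity n) (f o x)).
- intros o x; induction (f o x) as [| n IH]; trivial.
  now rewrite div2_S, <- IH.
- apply tc_rec; tc; apply tc_parity; tc.
Qed.

(** The quotient is found by search, as the least [n] with [f < (g + 1) * (n + 1)]; the successor in
    the divisor makes the search end. *)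
Lemma tc_div f g : total_computable f -> total_computable g ->
  total_computable (fun o x => f o x / S (g o x)).
Proof.
intros Hf Hg.
apply tc_mu with (t := fun o x n => S (f o x) - S (g o x) * S n).
- assert (Hf' := tc_comp f _ Hf (tc_left _ tc_id)).
  assert (Hg' := tc_comp g _ Hg (tc_left _ tc_id)).
  tc.
- intros o x; assert (H := Nat.mul_succ_div_gt (f o x) (S (g o x)) ltac:(lia)); lia.
- intros o x n Hn.
  assert (H := Nat.Div0.mul_div_le (f o x) (S (g o x))).
  assert (S (g o x) * S n <= S (g o x) * (f o x / S (g o x)))
    by (apply Nat.mul_le_mono_l; lia).
  lia.
Qed.

(** * From total functionals to computable maps of names *)

Lemma computable_total (F : baire -> baire) :
  total_computable F -> computable (fun p => Some (F p)).
Proof. intros [c Hc]; exists c; intros p q [= <-]; apply Hc. Qed.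

Lemma join_even p q n : join p q (2 * n) = p n.
Proof.
unfold join; now rewrite Nat.even_even, Nat.div2_double.
Qed.

Lemma join_odd p q n : join p q (S (2 * n)) = q n.
Proof.
unfold join; rewrite Nat.even_succ, Nat.odd_even, Nat.div2_succ_double; trivial.
Qed.

Lemma computable2_total (F : baire -> baire -> baire) :
  total_computable
    (fun o => F (fun n => o (2 * n)) (fun n => o (S (2 * n)))) ->
  computable2 (fun p q => Some (F p q)).
Proof.
intros [c Hc]; exists c; intros p q r [= <-] n.
specialize (Hc (join p q) n).
replace (fun n => join p q (2 * n)) with p in Hc.
2: { apply functional_extensionality; intros; now rewrite join_even. }
replace (fun n => join p q (S (2 * n))) with q in Hc; trivial.
apply functional_extensionality; intros; now rewrite join_odd.
Qed.

(** * Composition of reductions *)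

(** If [d] computes [q] from [p], the result simulates with oracle [p] what [c] does with oracle
    [q]; this composes computable maps. *)
Fixpoint subst_oracle (c d : code) : code :=
  match c with
  | Oracle => d
  | Pair a b => Pair (subst_oracle a d) (subst_oracle b d)
  | Comp a b => Comp (subst_oracle a d) (subst_oracle b d)
  | Rec a b => Rec (subst_oracle a d) (subst_oracle b d)
  | Mu a => Mu (subst_oracle a d)
  | Zero | Succ | Fst | Snd => c
  end.

Lemma eval_subst_oracle p q c d :
  (forall n, eval p d n (q n)) ->
  forall x y, eval q c x y -> eval p (subst_oracle c d) x y.
Proof.
intros Hd x y H.
induction H; simpl; try (econstructor; eassumption); apply Hd.
Qed.

(** Both halves are evaluated before the parity selects one, which is harmless because [c] and [d]
    halt on every input. *)
Lemma join_code c d : exists e, forall o p q,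
  (forall n, eval o c n (p n)) -> (forall n, eval o d n (q n)) ->
  forall n, eval o e n (join p q n).
Proof.
destruct (tc_parity _ tc_id) as [par Hpar].
destruct (tc_div2 _ tc_id) as [half Hhalf].
assert (Hsel : total_computable (fun _ v =>
  match lproj v with 0 => lproj (rproj v) | S _ => rproj (rproj v) end)) by tc.
destruct Hsel as [sel Hsel].
exists (Comp sel (Pair par (Pair (Comp c half) (Comp d half)))).
intros o p q Hc Hd n.
eapply eval_Comp.
- apply eval_Pair; [apply Hpar |].
  apply eval_Pair; (eapply eval_Comp; [apply Hhalf |]); [apply Hc | apply Hd].
- specialize (Hsel o (cpair (parity n)
    (cpair (p (Nat.div2 n)) (q (Nat.div2 n))))).
  rewrite !Cantor.cancel_of_to in Hsel; cbn [fst snd] in Hsel.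
  rewrite !Cantor.cancel_of_to in Hsel; cbn [fst snd] in Hsel.
  unfold join; unfold parity in *; now destruct (Nat.even n).
Qed.

Lemma weihrauch_le_trans {X1 Y1 X2 Y2 X3 Y3 : rep_space}
    (f : pmfun X1 Y1) (g : pmfun X2 Y2) (h : pmfun X3 Y3) :
  weihrauch_le f g -> weihrauch_le g h -> weihrauch_le f h.
Proof.
intros (H1 & K1 & [h1 Hh1] & [k1 Hk1] & Hfg) (H2 & K2 & [h2 Hh2] & [k2 Hk2] & Hgh).
exists (fun p => opt_bind (H1 p) H2).
(* The outer map sees only [p] and the answer [r], so it recomputes [u = H1 p] before applying [K2]
   and then [K1]. *)
exists (fun p r => opt_bind (opt_bind (H1 p) (fun u => K2 u r)) (K1 p)).
split; [| split].
- exists (subst_oracle h2 h1); intros p q E n.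
  destruct (H1 p) as [u |] eqn:Eu; simpl in E; [| discriminate].
  apply eval_subst_oracle with u; eauto.
(* [ev] and [od] read [p] and [r] off [join p r]; [j1] computes [join u r], and [j2] computes
   [join p v] with [v] the output of [K2]. *)
- destruct (tc_oracle _ (tc_mul _ _ (tc_const 2) tc_id)) as [ev Hev].
  destruct (tc_oracle _ (tc_succ _ (tc_mul _ _ (tc_const 2) tc_id))) as [od Hod].
  destruct (join_code (subst_oracle h1 ev) od) as [j1 Hj1].
  destruct (join_code ev (subst_oracle k2 j1)) as [j2 Hj2].
  exists (subst_oracle k1 j2); intros p r s E n.
  destruct (H1 p) as [u |] eqn:Eu; simpl in E; [| discriminate].
  destruct (K2 u r) as [v |] eqn:Ev; simpl in E; [| discriminate].
  assert (Hp : forall n, eval (join p r) ev n (p n)).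
  { intros m; rewrite <- (join_even p r m); apply Hev. }
  assert (Hr : forall n, eval (join p r) od n (r n)).
  { intros m; rewrite <- (join_odd p r m); apply Hod. }
  apply eval_subst_oracle with (join p v); [| eauto].
  apply Hj2; [exact Hp |]; intros m.
  apply eval_subst_oracle with (join u r); [| eauto].
  apply Hj1; [| exact Hr]; intros i.
  apply eval_subst_oracle with p; eauto.
- intros G HG p x Hp Hx.
  destruct (Hfg _ (Hgh G HG) p x Hp Hx) as (q & y & E & Hq).
  exists q, y; split; [| exact Hq].
  rewrite <- E; destruct (H1 p) as [u |]; simpl; trivial.
  destruct (H2 u) as [w |]; simpl; trivial.
  now destruct (G w).
Qed.

(** * Complex power series *)

Local Open Scope R_scope.

(** The index counts terms, as the length in [poly_sum] does, whereas [sum_n] at [n] has [n + 1]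
    terms. *)
Fixpoint psum (a : nat -> C) (z : C) (n : nat) : C :=
  match n with
  | O => 0%C
  | S m => (psum a z m + a m * Cpow z m)%C
  end.

Lemma pow_n_Cpow (z : C) k : @pow_n C_AbsRing z k = Cpow z k.
Proof. induction k as [| k IH]; simpl; [reflexivity | now rewrite IH]. Qed.

Lemma sum_n_psum (a : nat -> C) (z : C) n :
  @sum_n C_AbelianMonoid (fun k => @scal C_AbsRing C_NormedModule
    (@pow_n C_AbsRing z k) (a k)) n = psum a z (S n).
Proof.
induction n as [| n IH].
- rewrite sum_O, pow_n_Cpow; cbn [psum]; rewrite Cplus_0_l; apply Cmult_comm.
- rewrite sum_Sn, IH, pow_n_Cpow; cbn [psum].
  change (psum a z (S n) + Cpow z (S n) * a (S n) =
          psum a z (S n) + a (S n) * Cpow z (S n))%C.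
  ring.
Qed.

Lemma is_pseries_psum (a : nat -> C) (z l : C) :
  @is_pseries C_AbsRing C_NormedModule a z l <->
  forall eps, 0 < eps -> exists N, forall n, (N <= n)%nat ->
    Cmod (psum a z n - l) < eps.
Proof.
unfold is_pseries, is_series; split.
- intros H eps He.
  assert (Hl := locally_le_locally_norm l _ (locally_norm_ball_norm l (mkposreal eps He))).
  destruct (H _ Hl) as [N HN]; exists (S N); intros [| n] Hn; [lia |].
  specialize (HN n ltac:(lia)); rewrite sum_n_psum in HN; exact HN.
- intros H P HP.
  destruct (locally_norm_le_locally l P HP) as [eps Heps].
  destruct (H eps (cond_pos eps)) as [N HN]; exists N; intros n Hn.
  apply Heps; rewrite sum_n_psum; apply HN; lia.
Qed.

Lemma pseries_unique (a : nat -> C) (z l l' : C) :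
  @is_pseries C_AbsRing C_NormedModule a z l ->
  @is_pseries C_AbsRing C_NormedModule a z l' -> l = l'.
Proof.
rewrite !is_pseries_psum; intros H H'; apply Cdist_eq0.
apply cond_eq; intros eps He.
rewrite Rminus_0_r, Rabs_pos_eq by apply Cmod_ge_0.
destruct (H (eps / 2)) as [N HN]; [lra |].
destruct (H' (eps / 2)) as [N' HN']; [lra |].
specialize (HN (N + N')%nat ltac:(lia)); specialize (HN' (N + N')%nat ltac:(lia)).
eapply Rle_lt_trans; [apply (Cdist_triangle _ (psum a z (N + N'))) |].
rewrite Cdist_sym; lra.
Qed.

Lemma eventually_bounded (u : nat -> R) B N :
  (forall k, (N <= k)%nat -> u k <= B) -> exists M, forall k, u k <= M.
Proof.
revert B; induction N as [| N IH]; intros B H.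
- exists B; intros k; apply H; lia.
- apply (IH (Rmax B (u N))); intros k Hk.
  destruct (Nat.eq_dec k N) as [-> | Hne]; [apply Rmax_r |].
  eapply Rle_trans; [apply H; lia | apply Rmax_l].
Qed.

(** A term is the difference of consecutive partial sums, so its modulus is at most 2 once these are
    within 1 of the limit. *)
Lemma ex_pseries_bounded (a : nat -> C) (z : C) :
  @ex_pseries C_AbsRing C_NormedModule a z ->
  exists M, forall k, Cmod (a k) * Cmod z ^ k <= M.
Proof.
intros [l H]; assert (Hl := proj1 (is_pseries_psum a z l) H); clear H.
destruct (Hl 1 Rlt_0_1) as [N HN].
apply eventually_bounded with (B := 2) (N := N); intros k Hk.
assert (H1 := HN k Hk); assert (H2 := HN (S k) ltac:(lia)).
rewrite <- Cmod_pow, <- Cmod_mult.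
replace (a k * Cpow z k)%C with (psum a z (S k) - psum a z k)%C by (simpl; ring).
assert (T := Cdist_triangle (psum a z (S k)) l (psum a z k)).
rewrite (Cdist_sym l) in T; lra.
Qed.

(** If no point of convergence had modulus above 1, then 1 would bound the set whose supremum is the
    radius. At a point beyond 1 the terms are bounded. *)
Lemma large_radius_bound (a : nat -> C) : large_radius a ->
  exists r M, 1 < r /\ forall k, Cmod (a k) * r ^ k <= M.
Proof.
unfold large_radius, conv_radius; intros H.
apply NNPP; intros Hn.
apply (Rbar_lt_not_le _ _ H), Lub_Rbar_correct.
intros r (z & -> & Hz); simpl.
apply Rnot_lt_le; intros Hr; apply Hn.
destruct (ex_pseries_bounded a z Hz) as [M HM]; eauto.
Qed.

Lemma finite_support_large_radius (a : nat -> C) N :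
  (forall k, (N <= k)%nat -> a k = RtoC 0) -> large_radius a.
Proof.
intros Ha.
assert (Hp : forall z, @is_pseries C_AbsRing C_NormedModule a z (psum a z N)).
{ intros z; apply is_pseries_psum; intros eps He; exists N; intros n Hn.
  replace (psum a z n) with (psum a z N).
  - unfold Cminus; rewrite Cplus_opp_r, Cmod_0; exact He.
  - induction Hn as [| n Hn IH]; trivial; simpl.
    rewrite (Ha n Hn), <- IH; ring. }
unfold large_radius, conv_radius.
apply Rbar_lt_le_trans with 2; [simpl; lra |].
apply Lub_Rbar_correct; exists (RtoC 2); split.
- rewrite Cmod_R, Rabs_pos_eq; lra.
- eexists; apply Hp.
Qed.

Lemma psum_diff_geometric (a : nat -> C) (z : C) B x :
  0 <= B -> 0 <= x < 1 -> Cmod z <= 1 ->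
  (forall k, Cmod (a k) <= B * x ^ k) ->
  forall n m, (n <= m)%nat -> Cmod (psum a z m - psum a z n) <= B * x ^ n / (1 - x).
Proof.
intros HB Hx Hz Ha n m Hnm.
apply Rle_trans with (B * (x ^ n - x ^ m) / (1 - x)).
- induction Hnm as [| m Hnm IH].
  + unfold Cminus, Rdiv; rewrite Cplus_opp_r, Cmod_0, Rminus_diag; lra.
  + simpl psum.
    replace (psum a z m + a m * Cpow z m - psum a z n)%C
      with (psum a z m - psum a z n + a m * Cpow z m)%C by ring.
    eapply Rle_trans; [apply Cmod_triangle |].
    replace (B * (x ^ n - x ^ S m) / (1 - x))
      with (B * (x ^ n - x ^ m) / (1 - x) + B * x ^ m) by (simpl; field; lra).
    apply Rplus_le_compat; trivial.
    rewrite Cmod_mult, <- (Rmult_1_r (B * x ^ m)).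
    apply Rmult_le_compat; auto using Cmod_ge_0, Cmod_pow_le1.
- apply Rmult_le_compat_r; [apply Rlt_le, Rinv_0_lt_compat; lra |].
  apply Rmult_le_compat_l; trivial.
  assert (0 <= x ^ m) by (apply pow_le; lra); lra.
Qed.

Lemma ex_pseries_geometric (a : nat -> C) (z : C) B x :
  0 <= B -> 0 <= x < 1 -> Cmod z <= 1 ->
  (forall k, Cmod (a k) <= B * x ^ k) ->
  @ex_pseries C_AbsRing C_NormedModule a z.
Proof.
intros HB Hx Hz Ha.
apply (@ex_series_le C_AbsRing C_CompleteNormedModule) with (b := fun k => B * x ^ k).
- intros k.
  rewrite pow_n_Cpow.
  change (Cmod (Cpow z k * a k) <= B * x ^ k).
  rewrite Cmod_mult, <- (Rmult_1_l (B * x ^ k)).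
  apply Rmult_le_compat; auto using Cmod_ge_0, Cmod_pow_le1.
- apply (@ex_series_scal R_AbsRing R_NormedModule B), ex_series_geom.
  rewrite Rabs_pos_eq; lra.
Qed.

(** Let [m] tend to infinity in [psum_diff_geometric]. *)
Lemma pseries_tail_geometric (a : nat -> C) (z l : C) B x n :
  0 <= B -> 0 <= x < 1 -> Cmod z <= 1 ->
  (forall k, Cmod (a k) <= B * x ^ k) ->
  @is_pseries C_AbsRing C_NormedModule a z l ->
  Cmod (l - psum a z n) <= B * x ^ n / (1 - x).
Proof.
intros HB Hx Hz Ha Hl; rewrite is_pseries_psum in Hl.
apply le_epsilon; intros eps He; destruct (Hl eps He) as [N HN].
specialize (HN (N + n)%nat ltac:(lia)).
assert (H := psum_diff_geometric a z B x HB Hx Hz Ha n (N + n) ltac:(lia)).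
assert (T := Cdist_triangle l (psum a z (N + n)) (psum a z n)).
rewrite (Cdist_sym l (psum a z (N + n))) in T; lra.
Qed.

(** * Geometric advice from closed choice *)

(** Clears denominators in [2^j |q| <= n], where [q = (a - b) / (c + 1)] is coded by [u]; the two
    truncated differences add up to [|a - b|]. *)
Definition rat_excess (u j n : nat) : nat :=
  2 ^ j * ((lproj (lproj u) - rproj (lproj u)) + (rproj (lproj u) - lproj (lproj u)))
  - n * S (rproj u).

Lemma rat_enumE u :
  rat_enum u = (INR (lproj (lproj u)) - INR (rproj (lproj u))) / INR (S (rproj u)).
Proof.
unfold rat_enum; destruct (Cantor.of_nat u) as [m c]; cbn [fst snd].
now destruct (Cantor.of_nat m).
Qed.

Lemma crat_enumE u : crat_enum u = (rat_enum (lproj u), rat_enum (rproj u)).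
Proof. unfold crat_enum; now destruct (Cantor.of_nat u). Qed.

Lemma INR_pow2 j : INR (2 ^ j) = 2 ^ j.
Proof. now rewrite pow_INR. Qed.

Lemma rat_excess_eq0 u j n :
  rat_excess u j n = 0%nat <-> 2 ^ j * Rabs (rat_enum u) <= INR n.
Proof.
unfold rat_excess; rewrite rat_enumE.
set (a := lproj (lproj u)); set (b := rproj (lproj u)); set (c := S (rproj u)).
assert (Hc : 0 < INR c) by (apply lt_0_INR; unfold c; lia).
assert (Hab : Rabs (INR a - INR b) = INR ((a - b) + (b - a))).
{ rewrite plus_INR; destruct (Nat.le_ge_cases a b) as [H | H].
  - replace (a - b)%nat with 0%nat by lia; rewrite minus_INR by exact H.
    apply le_INR in H; rewrite Rabs_left1 by lra; simpl; lra.
  - replace (b - a)%nat with 0%nat by lia; rewrite minus_INR by exact H.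
    apply le_INR in H; rewrite Rabs_pos_eq by lra; simpl; lra. }
unfold Rdiv; rewrite Rabs_mult, Hab, (Rabs_pos_eq (/ INR c)), <- INR_pow2, <- Rmult_assoc
  by (apply Rlt_le, Rinv_0_lt_compat, Hc).
rewrite <- mult_INR, Nat.sub_0_le.
etransitivity; [| symmetry; exact (Rle_div_l _ _ _ Hc)].
rewrite <- mult_INR; split; [apply le_INR | apply INR_le].
Qed.

(** Reading coefficient [k] at precision [k] costs at most 1 after scaling by [2^j], since [j <= k]
    in every use. *)
Definition adv_test (p : baire) (n k j : nat) : nat :=
  rat_excess (lproj (p (cpair k k))) j n + rat_excess (rproj (p (cpair k k))) j n.

(* With [i = <n, <j, r>>], the coefficient of index [k = j (n + 1) + r] is
   tested against [n 2^-j]; as [r] is unrestricted, no division is needed to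
   reach every [k] with [j = k / (n + 1)]. *)
Definition adv_reject (p : baire) (i : nat) : nat :=
  match adv_test p (lproj i)
          (lproj (rproj i) * S (lproj i) + rproj (rproj i)) (lproj (rproj i))
  with
  | O => 0
  | S _ => S (lproj i)
  end.

Lemma tc_rat_excess u j n :
  total_computable u -> total_computable j -> total_computable n ->
  total_computable (fun o x => rat_excess (u o x) (j o x) (n o x)).
Proof. intros Hu Hj Hn; unfold rat_excess; tc. Qed.

Lemma tc_adv_reject : total_computable adv_reject.
Proof.
unfold adv_reject, adv_test; apply tc_case; tc; apply tc_rat_excess; tc.
Qed.

Definition adv_candidates (p : baire) (n : nat) : Prop :=
  forall j r, adv_test p n (j * S n + r) j = 0%nat.

Lemma adv_reject_names p : closed_nat_names (adv_reject p) (adv_candidates p).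
Proof.
intros m; unfold adv_reject; split.
- intros H.
  apply not_all_ex_not in H; destruct H as [j H].
  apply not_all_ex_not in H; destruct H as [r H].
  exists (cpair m (cpair j r)).
  repeat (rewrite !Cantor.cancel_of_to; cbn [fst snd]).
  destruct (adv_test p m (j * S m + r) j); [congruence | lia].
- intros [i [Hi ->]] H.
  specialize (H (lproj (rproj i)) (rproj (rproj i))).
  destruct (adv_test p (lproj i) _ _) eqn:E; [lia |].
  simpl Nat.sub in H; rewrite Nat.sub_0_r, E in H; discriminate.
Qed.

Lemma adv_test_eq0 p n k j :
  adv_test p n k j = 0%nat <->
  2 ^ j * Rabs (Re (crat_enum (p (cpair k k)))) <= INR n /\
  2 ^ j * Rabs (Im (crat_enum (p (cpair k k)))) <= INR n.
Proof.
unfold adv_test; rewrite Nat.eq_add_0, !rat_excess_eq0, crat_enumE; reflexivity.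
Qed.

Lemma coeff_approx p (a : nat -> C) k n : @names (seq_space C_space) p a ->
  Cmod (a k - crat_enum (p (cpair k n))) < (/ 2) ^ n.
Proof. intros Hp; exact (Hp k n). Qed.

(** Fix [r > 1] and [M] with [|a_k| r^k <= M]. If [r^(n+1) >= 2], then [2^j <= r^k] for
    [k >= j (n+1)], so [2^j |a_k| <= M], and rounding adds at most 1. *)
Lemma adv_candidates_nonempty p (a : nat -> C) :
  @names (seq_space C_space) p a -> large_radius a ->
  exists n, adv_candidates p n.
Proof.
intros Hp Ha; destruct (large_radius_bound a Ha) as (r & M & Hr & HM).
destruct (Pow_x_infinity r) with (b := 2) as [N HN].
{ rewrite Rabs_pos_eq; lra. }
destruct (INR_unbounded (M + 1)) as [N' HN'].
(* [N] ensures [r ^ S n >= 2] and [N'] ensures [n >= M + 1]; both persist for larger [n], so the sum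
   meets both. *)
exists (N + N')%nat; intros j s; apply adv_test_eq0.
set (n := (N + N')%nat); set (k := (j * S n + s)%nat).
assert (Hn : M + 1 <= INR n).
{ unfold n; rewrite plus_INR; assert (H := pos_INR N); lra. }
assert (Hjk : 2 ^ j <= r ^ k).
{ unfold k; rewrite pow_add, Nat.mul_comm, pow_mult.
  specialize (HN (S n) ltac:(unfold n; lia)).
  rewrite Rabs_pos_eq in HN by (apply pow_le; lra).
  assert (H1 : 2 ^ j <= (r ^ S n) ^ j) by (apply pow_incr; lra).
  assert (H2 : 1 <= r ^ s) by (apply pow_R1_Rle; lra).
  assert (H3 : 0 < 2 ^ j) by (apply pow_lt; lra).
  nra. }
assert (Hjk2 : 2 ^ j * (/ 2) ^ k <= 1).
{ rewrite pow_inv; apply Rle_div_l; [apply pow_lt; lra |].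
  rewrite Rmult_1_l; apply Rle_pow; [lra | unfold k; nia]. }
assert (H2j : 0 < 2 ^ j) by (apply pow_lt; lra).
assert (Hq : 2 ^ j * Cmod (crat_enum (p (cpair k k))) <= INR n).
{ assert (Hk := coeff_approx p a k k Hp).
  assert (T := Cmod_triangle (a k) (crat_enum (p (cpair k k)) - a k)).
  replace (a k + (crat_enum (p (cpair k k)) - a k))%C
    with (crat_enum (p (cpair k k))) in T by ring.
  rewrite (Cdist_sym _ (a k)) in T.
  specialize (HM k).
  assert (Ha1 := Rmult_le_compat_l _ _ _ (Cmod_ge_0 (a k)) Hjk).
  apply Rle_trans with (2 ^ j * (Cmod (a k) + (/ 2) ^ k)); [| lra].
  apply Rmult_le_compat_l; lra. }
assert (HRe := re_le_Cmod (crat_enum (p (cpair k k)))).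
assert (HIm := im_le_Cmod (crat_enum (p (cpair k k)))).
split; eapply Rle_trans; try exact Hq; apply Rmult_le_compat_l; trivial; lra.
Qed.

(** Let [j] be the integer quotient of [k] by [n + 1]. Two coordinates and the rounding error give
    [|a_k| <= (2n+1) 2^-j]. As [k <= (j+1)(n+1)], the advised power of 2 is at least [2^-(j+1)]; the
    lost factor 2 turns [2n+1] into [4n+2]. *)
Lemma adv_candidates_sound p (a : nat -> C) n k :
  @names (seq_space C_space) p a -> adv_candidates p n ->
  Cmod (a k) <= Rpower 2 (- (INR k / INR (4 * n + 2 + 1))) * INR (4 * n + 2).
Proof.
intros Hp Hn.
set (j := (k / S n)%nat).
assert (Hk : k = (j * S n + k mod S n)%nat).
{ rewrite Nat.mul_comm; apply Nat.div_mod_eq. }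
assert (Hkj : (k <= (j + 1) * S n)%nat).
{ assert (H := Nat.mod_upper_bound k (S n) ltac:(lia)); nia. }
specialize (Hn j (k mod S n)); rewrite <- Hk in Hn.
apply adv_test_eq0 in Hn; destruct Hn as [HRe HIm].
set (q := crat_enum (p (cpair k k))) in *.
assert (Hq : Cmod q <= Rabs (Re q) + Rabs (Im q)).
{ replace q with (RtoC (Re q) + Ci * RtoC (Im q))%C at 1.
  2: { destruct q; unfold Cplus, Cmult, Ci, RtoC; simpl; f_equal; ring. }
  eapply Rle_trans; [apply Cmod_triangle |].
  rewrite Cmod_mult, Cmod_Ci, !Cmod_R; lra. }
assert (Haq : Cmod (a k) <= Cmod q + (/ 2) ^ k).
{ assert (H := coeff_approx p a k k Hp); fold q in H.
  assert (T := Cmod_triangle q (a k - q)).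
  replace (q + (a k - q))%C with (a k) in T by ring; lra. }
assert (H2j : 0 < 2 ^ j) by (apply pow_lt; lra).
assert (H2k : 2 ^ j * (/ 2) ^ k <= 1).
{ rewrite pow_inv; apply Rle_div_l; [apply pow_lt; lra |].
  rewrite Rmult_1_l; apply Rle_pow; [lra | nia]. }
assert (Hpow : 1 <= 2 * 2 ^ j * Rpower 2 (- (INR k / INR (4 * n + 2 + 1)))).
{ change (2 * 2 ^ j) with (2 ^ S j).
  rewrite <- Rpower_pow, <- Rpower_plus by lra.
  rewrite <- (Rpower_O 2) at 1 by lra.
  apply Rle_Rpower; [lra |].
  enough (INR k / INR (4 * n + 2 + 1) <= INR (S j)) by lra.
  apply Rle_div_l; [apply lt_0_INR; lia |].
  rewrite <- mult_INR; apply le_INR; nia. }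
set (x := Rpower 2 _) in *.
rewrite plus_INR, mult_INR; simpl (INR 4); simpl (INR 2).
assert (HnR := pos_INR n).
apply Rmult_le_reg_l with (2 ^ j); trivial.
apply Rle_trans with (2 * INR n + 1); [nra |].
replace (2 ^ j * (x * (_ + _))) with (2 * 2 ^ j * x * (2 * INR n + 1)) by ring.
nra.
Qed.

Lemma adv_geometric_le_closed_choice :
  weihrauch_le adv_geometric closed_choice_nat.
Proof.
exists (fun p => Some (adv_reject p)), (fun _ q => Some (fun _ => (4 * q 0 + 2)%nat)).
split; [| split].
- apply computable_total, tc_adv_reject.
- apply computable2_total; tc.
- intros G HG p a Hp Ha; simpl.
  destruct (HG (adv_reject p) (adv_candidates p)) as (q & n & Hq & Hn & Hcand).
  + apply adv_reject_names.
  + exact (adv_candidates_nonempty p a Hp Ha).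
  + simpl in Hn; rewrite Hq; simpl.
    eexists; exists (4 * n + 2)%nat; split; [reflexivity |]; split.
    * now rewrite Hn.
    * intros k; now apply adv_candidates_sound with p.
Qed.

(** * Summation from geometric advice *)

(** New monomials go to the front, so indices decrease along the code; the conjugate gets exponent
    0. Precision [k + m + 2] makes the coefficient errors sum to at most [2^-(m+1)]. *)
Definition psum_code (p : baire) (m s : nat) : nat :=
  nat_rect (fun _ => nat) 0%nat
    (fun k t => cpair (cpair (cpair k 0) (p (cpair k (k + m + 2)))) t) s.

Lemma poly_enum_psum_code p m s z :
  poly_enum (cpair s (psum_code p m s)) z =
  psum (fun k => crat_enum (p (cpair k (k + m + 2)))) z s.
Proof.
unfold poly_enum; rewrite Cantor.cancel_of_to.
induction s as [| s IH]; [reflexivity |].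
cbn [poly_sum psum psum_code nat_rect]; fold (psum_code p m s).
rewrite Cantor.cancel_of_to, IH; unfold monomial_enum.
rewrite !Cantor.cancel_of_to.
change (Cpow (Cconj z) 0) with (RtoC 1); ring.
Qed.

(** With [x = 2^(-1/(n+1))], each [n + 1] further terms halve the tail bound. Of the [m + 2n + 3]
    halvings, [2n + 1] absorb the factor [n / (1 - x)] and [m + 2] give the precision. *)
Definition sum_length (n m : nat) : nat := S n * (m + 2 * n + 3).

Definition sum_name (p r : baire) (m : nat) : nat :=
  cpair (sum_length (r 0%nat) m) (psum_code p m (sum_length (r 0%nat) m)).

Lemma computable2_sum_name : computable2 (fun p r => Some (sum_name p r)).
Proof.
apply computable2_total; unfold sum_name, psum_code, sum_length; tc.
apply tc_rec; tc.
Qed.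

Lemma psum_minus (a b : nat -> C) z s :
  psum (fun k => (a k - b k)%C) z s = (psum a z s - psum b z s)%C.
Proof.
induction s as [| s IH]; simpl; [ring |].
rewrite IH; ring.
Qed.

Lemma psum_close (a b : nat -> C) z e s :
  0 <= e -> Cmod z <= 1 -> (forall k, Cmod (a k - b k) <= e * (/ 2) ^ k) ->
  Cmod (psum a z s - psum b z s) <= 2 * e.
Proof.
intros He Hz H.
assert (T := psum_diff_geometric _ z e (/ 2) He ltac:(lra) Hz H 0 s ltac:(lia)).
rewrite psum_minus in T; simpl in T.
replace (psum a z s - psum b z s - 0)%C
  with (psum a z s - psum b z s)%C in T by ring; lra.
Qed.

(** [1 - x^m] is [1 - x] times a sum of [m] powers of [x], each at most 1. For [x^(n+1) = 1/2] this
    bounds [1 - x] below by [1 / (2(n+1))]. *)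
Lemma one_minus_pow_le x m : 0 <= x <= 1 -> 1 - x ^ m <= INR m * (1 - x).
Proof.
intros Hx; induction m as [| m IH]; [simpl; lra |].
rewrite S_INR; simpl.
assert (0 <= x ^ m <= 1).
{ split; [apply pow_le; lra | rewrite <- (pow1 m); apply pow_incr; lra]. }
nra.
Qed.

Lemma INR_S_le_pow2 n : INR (S n) <= 2 ^ n.
Proof.
rewrite <- INR_pow2; apply le_INR.
assert (H := Nat.pow_gt_lin_r 2 n); lia.
Qed.

Lemma Rpower_geometric n k :
  Rpower 2 (- (INR k / INR (n + 1))) = Rpower 2 (- / INR (S n)) ^ k.
Proof.
rewrite <- Rpower_pow by apply exp_pos.
rewrite Rpower_mult, Nat.add_1_r; f_equal.
field; apply not_0_INR; lia.
Qed.

Lemma half_root_pow n : Rpower 2 (- / INR (S n)) ^ S n = / 2.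
Proof.
rewrite <- Rpower_geometric, Nat.add_1_r.
replace (- (INR (S n) / INR (S n))) with (- (1)).
- rewrite Rpower_Ropp, Rpower_1; lra.
- field; apply not_0_INR; lia.
Qed.

Lemma half_root_lt1 n : 0 < Rpower 2 (- / INR (S n)) < 1.
Proof.
split; [apply exp_pos |].
rewrite <- (Rpower_O 2) by lra; apply Rpower_lt; [lra |].
assert (0 < / INR (S n)); [| lra].
apply Rinv_0_lt_compat, lt_0_INR; lia.
Qed.

Lemma half_root_tail n m :
  let x := Rpower 2 (- / INR (S n)) in
  INR n * x ^ sum_length n m / (1 - x) <= (/ 2) ^ (m + 2).
Proof.
intros x; unfold sum_length.
assert (Hx := half_root_lt1 n); fold x in Hx.
rewrite pow_mult; unfold x at 1; rewrite half_root_pow; fold x.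
assert (H1 := one_minus_pow_le x (S n) ltac:(lra)).
unfold x at 1 in H1; rewrite half_root_pow in H1; fold x in H1.
apply Rle_div_l; [lra |].
replace (m + 2 * n + 3)%nat with ((m + 2) + S (n + n))%nat by lia.
rewrite pow_add.
set (e := (/ 2) ^ (m + 2)).
assert (He : 0 < e) by (apply pow_lt; lra).
replace (INR n * (e * (/ 2) ^ S (n + n))) with (e * (INR n * (/ 2) ^ S (n + n))) by ring.
apply Rmult_le_compat_l; [lra |].
rewrite pow_inv; apply Rle_div_l; [apply pow_lt; lra |].
simpl pow; rewrite pow_add.
assert (Hn := INR_S_le_pow2 n); assert (HnS := S_INR n).
assert (Hn0 := pos_INR n).
set (N := 2 ^ n) in *.
(* Since [(n + 1)(1 - x) >= 1/2], one factor [N >= n] is left; the other [N] dominates [n + 1]. *)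
apply Rle_trans with ((1 - x) * (2 * (INR (S n) * N))).
- nra.
- apply Rmult_le_compat_l; [lra |]. nra.
Qed.

(** A uniform limit of continuous functions is continuous. Pointwise bounds give only a weak bound
    on the supremum; the factor 3/4 restores the strict one required of a name. *)
Lemma CD_of_poly_limit (g : disk -> C) (c : nat -> nat) :
  (forall m x, Cmod (g x - poly_enum (c m) x) <= 3 / 4 * (/ 2) ^ m) ->
  exists f : CD, (forall x, f x = g x) /\ @metric_names CD_metric c f.
Proof.
intros H.
assert (Hg : forall (x : disk) (eps : R), 0 < eps -> exists delta, 0 < delta /\
          forall y : disk, Cmod (y - x) < delta -> Cmod (g y - g x) < eps).
{ intros x eps He.
  destruct (pow_half_lt (eps / 3)) as [m Hm]; [lra |].
  destruct (poly_enum_cont (c m) x (eps / 3)) as (d & Hd & Hcont); [lra |].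
  exists d; split; trivial; intros y Hy.
  specialize (Hcont y Hy).
  assert (Hx' := H m x); assert (Hy' := H m y).
  assert (T1 := Cdist_triangle (g y) (poly_enum (c m) y) (g x)).
  assert (T2 := Cdist_triangle (poly_enum (c m) y) (poly_enum (c m) x) (g x)).
  rewrite (Cdist_sym (poly_enum (c m) x) (g x)) in T2.
  assert (0 < (/ 2) ^ m) by (apply pow_lt; lra); lra. }
exists (MkCD g Hg); split; [reflexivity |]; intros m.
apply Rle_lt_trans with (3 / 4 * (/ 2) ^ m).
- apply sup_dist_spec; intros x; apply H.
- assert (0 < (/ 2) ^ m) by (apply pow_lt; lra); lra.
Qed.

Lemma power_sum_le_adv_geometric : weihrauch_le power_sum adv_geometric.
Proof.
exists Some, (fun p r => Some (sum_name p r)).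
split; [apply (computable_total (fun p => p)), tc_oracle, tc_id |].
split; [apply computable2_sum_name |].
intros G HG p a Hp Ha; simpl.
destruct (HG p a Hp Ha) as (r & n & HGp & Hr & Hn); rewrite HGp; simpl.
simpl in Hr, Hn.
set (x := Rpower 2 (- / INR (S n))).
assert (Hx : 0 <= x < 1) by (assert (H := half_root_lt1 n); fold x in H; lra).
assert (Hbound : forall k, Cmod (a k) <= INR n * x ^ k).
{ intros k; specialize (Hn k); rewrite Rpower_geometric in Hn; fold x in Hn; lra. }
assert (Hex : forall z : disk, exists l,
          @is_pseries C_AbsRing C_NormedModule a (z : C) l).
{ intros z; apply ex_pseries_geometric with (INR n) x;
    auto using pos_INR; exact (proj2_sig z). }
pose (g := fun z => proj1_sig (constructive_indefinite_description _ (Hex z))).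
assert (Hg : forall z : disk, @is_pseries C_AbsRing C_NormedModule a (z : C) (g z)).
{ intros z; exact (proj2_sig (constructive_indefinite_description _ (Hex z))). }
clearbody g.
destruct (CD_of_poly_limit g (sum_name p r)) as (f & Hf & Hname).
(* The truncated tail contributes [2^-(m+2)] and the rounded coefficients [2 * 2^-(m+2)], together
   [3/4 * 2^-m]. *)
{ intros m z.
  assert (Hz := proj2_sig z : Cmod z <= 1).
  unfold sum_name; rewrite poly_enum_psum_code, Hr.
  set (L := sum_length n m).
  eapply Rle_trans; [apply (Cdist_triangle _ (psum a z L)) |].
  assert (H1 := pseries_tail_geometric a z (g z) (INR n) x L
                  (pos_INR n) Hx Hz Hbound (Hg z)).
  assert (H2 := half_root_tail n m); cbv zeta in H2; fold x in H2; fold L in H2.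
  assert (H3 := psum_close a (fun k => crat_enum (p (cpair k (k + m + 2)))) z
    ((/ 2) ^ (m + 2)) L).
  rewrite pow_add in H2, H3; replace ((/ 2) ^ 2) with (/ 4) in H2, H3 by field.
  assert (H0 : 0 < (/ 2) ^ m) by (apply pow_lt; lra).
  enough (forall k, Cmod (a k - crat_enum (p (cpair k (k + m + 2)))) <=
            (/ 2) ^ m * / 4 * (/ 2) ^ k).
  { specialize (H3 ltac:(lra) Hz H); lra. }
  intros k; assert (Hk := coeff_approx p a k (k + m + 2) Hp).
  rewrite !pow_add in Hk; replace ((/ 2) ^ 2) with (/ 4) in Hk by field; lra. }
exists (sum_name p r), f; split; [reflexivity |]; split; [exact Hname |].
intros z; rewrite Hf; apply Hg.
Qed.

(** * Closed choice from summation *)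

Local Open Scope nat_scope.

(** [S g] is the entry that expels [g] from the named set; the two truncated differences vanish
    together exactly when [p i = S g]. *)
Definition hit (p : baire) (g s : nat) : nat :=
  nat_rect (fun _ => nat) 0
    (fun i y => match (p i - S g) + (S g - p i) with 0 => 1 | S _ => y end) s.

Lemma hitP p g s :
  (hit p g s = 1 /\ exists i, i < s /\ p i = S g) \/
  (hit p g s = 0 /\ forall i, i < s -> p i <> S g).
Proof.
induction s as [| s IH]; [right; split; [reflexivity | lia] |].
cbn [hit nat_rect]; fold (hit p g s).
destruct (p s - S g + (S g - p s)) eqn:E; [left; split; trivial; exists s; lia |].
destruct IH as [[-> (i & Hi & Hp)] | [-> H]].
- left; split; trivial; exists i; lia.
- right; split; trivial; intros i Hi.
  destruct (Nat.eq_dec i s) as [-> | Hne]; [lia | apply (H i); lia].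
Qed.

Lemma tc_hit g s : total_computable g -> total_computable s ->
  total_computable (fun o x => hit o (g o x) (s o x)).
Proof.
intros Hg Hs; unfold hit; apply tc_rec; tc;
  apply (tc_comp g); tc.
Qed.

(* The guess moves to the next number as soon as it is seen to be outside the
   set, so it converges to the least element of the set. *)
Definition guess (p : baire) (s : nat) : nat :=
  nat_rect (fun _ => nat) 0 (fun s g => g + hit p g s) s.

Definition guess_incr (p : baire) (s : nat) : nat := hit p (guess p s) s.

Lemma guess_S p s : guess p (S s) = guess p s + guess_incr p s.
Proof. reflexivity. Qed.

(** Induction on the bound: either it is attained, and the sequence stays there, or it can be
    lowered by one. *)
Lemma monotone_bounded_stable (u : nat -> nat) b :
  (forall s, u s <= u (S s)) -> (forall s, u s <= b) ->
  exists N, forall s, N <= s -> u s = u N.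
Proof.
intros Hmon; induction b as [| b IH]; intros Hb.
- exists 0; intros s _; assert (H1 := Hb s); assert (H2 := Hb 0); lia.
- destruct (classic (exists N, u N = S b)) as [[N HN] | Hn].
  + exists N; intros s Hs; rewrite HN; induction Hs as [| s Hs IHs]; trivial.
    assert (H1 := Hmon s); assert (H2 := Hb (S s)); lia.
  + apply IH; intros s.
    assert (H := Hb s); assert (u s <> S b) by (intros E; apply Hn; eauto); lia.
Qed.

Lemma guess_limit p A : closed_nat_names p A -> (exists n, A n) ->
  exists N, A (guess p N) /\
    forall s, N <= s -> guess p s = guess p N /\ guess_incr p s = 0.
Proof.
intros Hp [n Hn].
(* The guess cannot pass an element [n] of [A], since [S n] is never listed. *)
assert (Hbound : forall s, guess p s <= n).
{ induction s as [| s IH]; [apply Nat.le_0_l |].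
  rewrite guess_S; unfold guess_incr.
  destruct (hitP p (guess p s) s) as [[-> (i & _ & Hi)] | [-> _]]; [| lia].
  enough (guess p s <> n) by lia.
  intros E; apply (proj2 (Hp n)); trivial; exists i; lia. }
destruct (monotone_bounded_stable (guess p) n) as [N HN]; trivial.
{ intros s; rewrite guess_S; lia. }
assert (Hincr : forall s, N <= s -> guess_incr p s = 0).
{ intros s Hs; assert (H1 := HN s Hs); assert (H2 := HN (S s) ltac:(lia)).
  rewrite guess_S in H2; lia. }
exists N; split; [| auto].
(* If the limit were outside [A], its entry at [i] would be seen by stage [N + S i] and force an
   increment. *)
apply NNPP; intros H; apply Hp in H; destruct H as (i & Hi & E).
assert (H1 := Hincr (N + S i) ltac:(lia)); unfold guess_incr in H1.
rewrite (HN (N + S i)) in H1 by lia.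
destruct (hitP p (guess p N) (N + S i)) as [[H2 _] | [_ H2]]; [lia |].
apply (H2 i); lia.
Qed.

Definition guess_coeff (p : baire) (s : nat) : C := RtoC (INR (guess_incr p s)).

(** The coefficients are natural numbers, so one exact code serves every precision; the code 0
    stands for the rational 0. *)
Definition guess_name (p : baire) (v : nat) : nat :=
  cpair (cpair (cpair (guess_incr p (lproj v)) 0) 0) 0.

Lemma tc_guess_name : total_computable guess_name.
Proof.
unfold guess_name; tc; unfold guess_incr, guess.
apply tc_hit; [apply tc_rec | ]; tc; apply tc_hit; tc.
Qed.

Lemma rat_enum_INR d : rat_enum (cpair (cpair d 0) 0) = INR d.
Proof.
rewrite rat_enumE; repeat (rewrite !Cantor.cancel_of_to; cbn [fst snd]).
simpl; field.
Qed.

Lemma rat_enum_0 : rat_enum 0 = 0%R.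
Proof. apply (rat_enum_INR 0). Qed.

Lemma guess_name_names p : @names (seq_space C_space) (guess_name p) (guess_coeff p).
Proof.
intros s n; unfold guess_name; rewrite Cantor.cancel_of_to.
change (Cmod (guess_coeff p s -
  crat_enum (cpair (cpair (cpair (guess_incr p s) 0) 0) 0)) < (/ 2) ^ n)%R.
rewrite crat_enumE, Cantor.cancel_of_to; cbn [fst snd].
rewrite rat_enum_INR, rat_enum_0.
rewrite (proj2 (Cdist_eq0 _ _)) by reflexivity.
apply pow_lt; lra.
Qed.

(** At 1 the increments telescope, starting from [guess p 0 = 0]. *)
Lemma psum_guess p s : psum (guess_coeff p) (RtoC 1) s = RtoC (INR (guess p s)).
Proof.
induction s as [| s IH]; [reflexivity |].
cbn [psum]; rewrite IH, guess_S, plus_INR, RtoC_plus; unfold guess_coeff.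
replace (Cpow (RtoC 1) s) with (RtoC 1); [ring |].
now rewrite <- RtoC_pow, pow1.
Qed.

(** * Evaluating polynomial codes at 1 and rounding *)

Definition rat_add (u v : nat) : nat :=
  cpair
    (cpair (lproj (lproj u) * S (rproj v) + lproj (lproj v) * S (rproj u))
           (rproj (lproj u) * S (rproj v) + rproj (lproj v) * S (rproj u)))
    (S (rproj u) * S (rproj v) - 1).

(** Denominators are coded by their predecessors, hence the final [- 1] in [rat_add]. *)
Lemma rat_enum_add u v : rat_enum (rat_add u v) = (rat_enum u + rat_enum v)%R.
Proof.
unfold rat_add; rewrite !rat_enumE.
repeat (rewrite !Cantor.cancel_of_to; cbn [fst snd]).
replace (S (S (rproj u) * S (rproj v) - 1)) with (S (rproj u) * S (rproj v)) by lia.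
rewrite !plus_INR, !mult_INR; field.
split; apply not_0_INR; lia.
Qed.

(* The state of the iteration pairs the code of the remaining monomials with
   the real part of the sum of the coefficients read so far. *)
Definition unit_step (v : nat) : nat :=
  cpair (rproj (lproj v)) (rat_add (rproj v) (lproj (rproj (lproj (lproj v))))).

Definition unit_iter (m s : nat) : nat :=
  nat_rect (fun _ => nat) (cpair m 0) (fun _ => unit_step) s.

Definition unit_value (w : nat) : nat := rproj (unit_iter (rproj w) (lproj w)).

Lemma monomial_enum_1 h : monomial_enum h (RtoC 1) = crat_enum (rproj h).
Proof.
unfold monomial_enum; destruct (Cantor.of_nat h) as [e c]; cbn [snd].
destruct (Cantor.of_nat e) as [i j].
replace (Cconj (RtoC 1)) with (RtoC 1) by (unfold Cconj, RtoC; simpl; f_equal; ring).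
rewrite <- !RtoC_pow, !pow1; ring.
Qed.

(** Splitting the length as [s + l] keeps the unread monomials in the invariant; [l = 0] is the case
    of interest. *)
Lemma unit_iter_spec m s l :
  Re (poly_sum (s + l) m (RtoC 1)) =
  (rat_enum (rproj (unit_iter m s)) + Re (poly_sum l (lproj (unit_iter m s)) (RtoC 1)))%R.
Proof.
revert l; induction s as [| s IH]; intros l.
- cbn [unit_iter nat_rect]; rewrite Cantor.cancel_of_to; cbn [fst snd].
  rewrite rat_enum_0; simpl Nat.add; ring.
- replace (S s + l) with (s + S l) by lia; rewrite IH; clear IH.
  cbn [unit_iter nat_rect]; fold (unit_iter m s).
  set (v := unit_iter m s); unfold unit_step.
  rewrite Cantor.cancel_of_to; cbn [fst snd poly_sum].
  rewrite rat_enum_add.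
  destruct (Cantor.of_nat (lproj v)) as [h t]; cbn [fst snd].
  rewrite monomial_enum_1, crat_enumE; unfold Re; simpl fst; ring.
Qed.

Lemma rat_enum_unit_value w : rat_enum (unit_value w) = Re (poly_enum w (RtoC 1)).
Proof.
unfold unit_value, poly_enum; destruct (Cantor.of_nat w) as [len m]; cbn [fst snd].
rewrite <- (Nat.add_0_r len) at 2; rewrite unit_iter_spec; simpl; ring.
Qed.

(** The floor of [q + 1/2]. A negative [q] is sent to 0, its nearest natural number; the divisor
    [2 (c + 1)] is written in the form that [tc_div] expects. *)
Definition nat_round (u : nat) : nat :=
  (2 * (lproj (lproj u) - rproj (lproj u)) + S (rproj u)) / S (S (2 * rproj u)).

Lemma nat_roundP u n :
  (Rabs (rat_enum u - INR n) < / 2)%R -> nat_round u = n.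
Proof.
rewrite rat_enumE; unfold nat_round.
set (a := lproj (lproj u)); set (b := rproj (lproj u)); set (c := rproj u).
assert (Hc : (0 < INR (S c))%R) by (apply lt_0_INR; lia).
intros H; apply Rabs_def2 in H.
assert (Ha : 2 * a < 2 * b + 2 * (n * S c) + S c).
{ apply INR_lt; rewrite !plus_INR, !mult_INR; simpl (INR 2).
  assert (H1 : ((INR a - INR b) / INR (S c) < INR n + / 2)%R) by lra.
  apply Rlt_div_l in H1; trivial; lra. }
assert (Hb : 2 * b + 2 * (n * S c) < 2 * a + S c).
{ apply INR_lt; rewrite !plus_INR, !mult_INR; simpl (INR 2).
  assert (H1 : (INR n - / 2 < (INR a - INR b) / INR (S c))%R) by lra.
  apply Rlt_div_r in H1; trivial; lra. }
symmetry; apply Nat.div_unique with (2 * (a - b) + S c - 2 * (n * S c)).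
- nia.
- nia.
Qed.

Lemma tc_nat_round u :
  total_computable u -> total_computable (fun o x => nat_round (u o x)).
Proof. intros Hu; unfold nat_round; apply tc_div; tc. Qed.

Lemma tc_unit_value w :
  total_computable w -> total_computable (fun o x => unit_value (w o x)).
Proof.
intros Hw; unfold unit_value, unit_iter, unit_step, rat_add.
apply tc_right, tc_rec; tc.
Qed.

Lemma disk1P : (Cmod (RtoC 1) <= 1)%R.
Proof. rewrite Cmod_1; lra. Qed.

Lemma closed_choice_le_power_sum : weihrauch_le closed_choice_nat power_sum.
Proof.
exists (fun p => Some (guess_name p)).
(* Precision 2 means an error below 1/4, which determines a natural number by rounding. *)
exists (fun _ q => Some (fun _ => nat_round (unit_value (q 2)))).
split; [apply computable_total, tc_guess_name |].
split; [apply computable2_total, tc_nat_round, tc_unit_value; tc |].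
intros G HG p A Hp HA; cbn [opt_bind].
destruct (guess_limit p A Hp HA) as (N & HN & Hlim).
assert (Hlarge : large_radius (guess_coeff p)).
{ apply finite_support_large_radius with N; intros k Hk.
  unfold guess_coeff; now rewrite (proj2 (Hlim k Hk)). }
destruct (HG _ _ (guess_name_names p) Hlarge) as (q & f & E & Hq & Hf).
rewrite E; cbn [opt_bind].
eexists; exists (guess p N); split; [reflexivity |]; split; [| exact HN].
apply nat_roundP; rewrite rat_enum_unit_value; set (w := q 2).
pose (one := exist _ (RtoC 1) disk1P : disk).
assert (Hf1 : f one = RtoC (INR (guess p N))).
{ apply pseries_unique with (guess_coeff p) (RtoC 1); [exact (Hf one) |].
  apply is_pseries_psum; intros eps He; exists N; intros n Hn.
  rewrite psum_guess, (proj1 (Hlim n Hn)).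
  now rewrite (proj2 (Cdist_eq0 _ _)). }
assert (Hd : (Cmod (f one - poly_enum w one) < / 4)%R).
{ eapply Rle_lt_trans; [apply (proj1 (sup_dist_spec f (CD_poly w)) one) |].
  replace (/ 4)%R with ((/ 2) ^ 2)%R by field; exact (Hq 2%nat). }
rewrite Hf1, Cdist_sym in Hd.
assert (H := re_le_Cmod (poly_enum w one - RtoC (INR (guess p N)))).
change (Re (poly_enum w one - RtoC (INR (guess p N))))
  with (Re (poly_enum w (RtoC 1)) - INR (guess p N))%R in H.
change (disk_val one) with (RtoC 1) in *; lra.
Qed.

Theorem theorem2p6 :
  weihrauch_equiv closed_choice_nat power_sum /\
  weihrauch_equiv closed_choice_nat adv_geometric /\
  weihrauch_equiv power_sum adv_geometric.
Proof.
assert (H1 := closed_choice_le_power_sum).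
assert (H2 := power_sum_le_adv_geometric).
assert (H3 := adv_geometric_le_closed_choice).
(* Three of the six reductions form a cycle; each of the others composes two of its arrows. *)
repeat split; trivial; eapply weihrauch_le_trans; eassumption.
Qed.
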